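(* Let $n\in\mathbb N$, let $K_1,\dots,K_n$ be singular, strictly concave kernel functions satisfying (PM$_0$), and let $J$ be an $n$-field function satisfying either - $(\infty_+)$: $J(0)=\lim_{t\downarrow0}J(t)=-\infty$, or - $(\infty_-)$: $J(1)=\lim_{t\uparrow1}J(t)=-\infty$. Then $\Phi|_Y:Y\to\mathbb R^n$ is a locally bi-Lipschitz homeomorphism of $Y$ onto $\mathbb R^n$.
   Context: A kernel function is a function $K:(-1,0)\cup(0,1)\to\mathbb R$ that is concave on $(-1,0)$ and concave on $(0,1)$ and satisfies $\lim_{t\downarrow0}K(t)=\lim_{t\uparrow0}K(t)$. It is extended to $[-1,1]$ with values in $[-\infty,\infty)$ by its one-sided limits at $-1,0,1$. It is singular if $K(0)=-\infty$. Strictly concave means strictly concave on each of $(-1,0)$ and $(0,1)$. For $c\ge0$, (PM$_c$) means $K'(t)-K'(t-1)\ge c$ for almost every $t\in(0,1)$. An $n$-field function is a function $J:[0,1]\to[-\infty,\infty)$ that is bounded above and whose set of finite values has total weight strictly greater than $n$. Here the points $0$ and $1$ each have weight $1/2$ and every point of $(0,1)$ has weight $1$. $S=\{\mathbf y\in\mathbb R^n:0<y_1<\dots<y_n<1\}$. $F(\mathbf y,t)=J(t)+\sum_{i=1}^nK_i(t-y_i)$, with the convention $a+(-\infty)=-\infty$. Set $y_0:=0$ and $y_{n+1}:=1$. Let $I_j(\mathbf y)=[y_j,y_{j+1}]$ and $m_j(\mathbf y)=\sup_{t\in I_j(\mathbf y)}F(\mathbf y,t)$. $Y=\{\mathbf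 y\in S:m_j(\mathbf y)\ne-\infty\ \forall j\}$. $\Phi(\mathbf y)=(m_1(\mathbf y)-m_0(\mathbf y),\dots,m_n(\mathbf y)-m_{n-1}(\mathbf y))$. *)

(* Defs.v *)
From HB Require Import structures.
From mathcomp Require Import all_boot all_order all_algebra.
From mathcomp Require Import all_classical all_reals all_analysis.
Set Implicit Arguments. Unset Strict Implicit. Unset Printing Implicit Defensive.
Import Order.TTheory GRing.Theory Num.Theory.
Import numFieldNormedType.Exports.
Local Open Scope classical_set_scope.
Local Open Scope ring_scope.

Section Defs.
Variable R : realType.

Definition concave_on (I : set R) (f : R -> R) : Prop :=
  forall x y l, I x -> I y -> 0 <= l <= 1 ->
    l * f x + (1 - l) * f y <= f (l * x + (1 - l) * y).

Definition strictly_concave_on (I : set R) (f : R -> R) : Prop :=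
  forall x y l, I x -> I y -> x != y -> 0 < l < 1 ->
    l * f x + (1 - l) * f y < f (l * x + (1 - l) * y).

(* A kernel function, already extended to [-1,1] by its one-sided limits:
   K : R -> \bar R, only its values on [-1,1] matter. *)
Definition kernel_function (K : R -> \bar R) : Prop :=
  [/\ (forall t, ((t \in `]-1, 0[) \/ (t \in `]0, 1[)) -> K t \is a fin_num),
      concave_on [set` `]-1, 0[] (fun t => fine (K t)),
      concave_on [set` `]0, 1[] (fun t => fine (K t)),
      K t @[t --> 0^'+] --> K 0 /\ K t @[t --> 0^'-] --> K 0 &
      K t @[t --> (-1)^'+] --> K (-1) /\ K t @[t --> 1^'-] --> K 1].

Definition singular_kernel (K : R -> \bar R) : Prop := K 0 = -oo%E.

Definition strictly_concave_kernel (K : R -> \bar R) : Prop :=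
  strictly_concave_on [set` `]-1, 0[] (fun t => fine (K t)) /\
  strictly_concave_on [set` `]0, 1[] (fun t => fine (K t)).

Definition PM (c : R) (K : R -> \bar R) : Prop :=
  {ae (@lebesgue_measure R), forall t : R, t \in `]0, 1[ ->
     derivable (fun s => fine (K s)) t 1 ->
     derivable (fun s => fine (K s)) (t - 1) 1 ->
     c <= derive1 (fun s => fine (K s)) t - derive1 (fun s => fine (K s)) (t - 1)}.

Definition weight (t : R) : \bar R :=
  if (t == 0) || (t == 1) then (2^-1)%:E else 1%:E.

(* n-field function J : [0,1] -> [-oo, oo) (values outside [0,1] irrelevant) *)
Definition n_field_function (n : nat) (J : R -> \bar R) : Prop :=
  (exists M : R, forall t, t \in `[0, 1] -> (J t <= M%:E)%E) /\
  lte (n%:R%:E) (\esum_(t in [set t : R | (t \in `[0, 1]) /\ J t \is a fin_num]) weight t).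

(* y_0 := 0, y_j := y_j (1 <= j <= n), y_{n+1} := 1  (paper indexing) *)
Definition ypt (n : nat) (y : 'rV[R]_n) (j : nat) : R :=
  match j with
  | 0 => 0
  | k.+1 => if (insub k : option 'I_n) is Some i then y ord0 i else 1
  end.

Definition Sset (n : nat) : set 'rV[R]_n :=
  [set y | forall j, (j <= n)%N -> ypt y j < ypt y j.+1].

Definition Ffun (n : nat) (J : R -> \bar R) (K : 'I_n -> R -> \bar R)
  (y : 'rV[R]_n) (t : R) : \bar R :=
  (J t + \sum_(i < n) K i (t - y ord0 i)%R)%E.

Definition msup (n : nat) (J : R -> \bar R) (K : 'I_n -> R -> \bar R)
  (y : 'rV[R]_n) (j : nat) : \bar R :=
  ereal_sup [set Ffun J K y t | t in `[ypt y j, ypt y j.+1]].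

Definition Yset (n : nat) (J : R -> \bar R) (K : 'I_n -> R -> \bar R)
  : set 'rV[R]_n :=
  [set y | Sset y /\ forall j, (j <= n)%N -> msup J K y j != -oo%E].

(* Phi(y)_i = m_{i+1}(y) - m_i(y)   (0-based component i = paper's i+1) *)
Definition Phi (n : nat) (J : R -> \bar R) (K : 'I_n -> R -> \bar R)
  (y : 'rV[R]_n) : 'rV[R]_n :=
  \row_(i < n) fine (msup J K y i.+1 - msup J K y i)%E.

Definition locally_bilipschitz_on (n : nat) (Y : set 'rV[R]_n)
  (f : 'rV[R]_n -> 'rV[R]_n) : Prop :=
  forall y, Y y -> exists2 e : R, 0 < e & exists2 L : R, 0 < L &
    forall a b, Y a -> Y b -> ball y e a -> ball y e b ->
      `|a - b| <= L * `|f a - f b| /\ `|f a - f b| <= L * `|a - b|.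

Definition homeomorphism_onto (n : nat) (Y : set 'rV[R]_n)
  (f : 'rV[R]_n -> 'rV[R]_n) : Prop :=
  exists g : 'rV[R]_n -> 'rV[R]_n,
    [/\ forall z, Y (g z),
        forall z, f (g z) = z,
        forall y, Y y -> g (f y) = y,
        {within Y, continuous f} &
        continuous g].

End Defs.

(* Main.v *)
(* Put M_j = exp m_j, a continuous function of the nodes.  Log-concavity of the
   branches of exp K_i gives an exchange inequality: if z >= y and z_i = y_i, then
   M_(i+1) / M_i does not decrease from y to z.  In the other direction, (PM_0),
   strict concavity and the condition at an end point show that moving the nodes
   to the right strictly decreases M_n / M_0, at a locally uniform linear rate.
   For two node systems a and b and z = max(a, b), the first fact bounds every
   component of Phi(z) from below by that of Phi(a) or Phi(b), and the second one
   bounds their sum m_n - m_0 from above; together they give injectivity and the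
   local lower Lipschitz bound.  The upper bound holds because near-maximisers
   stay away from the nodes, where the kernels are locally Lipschitz.  For
   surjectivity, maximise the sum of the nodes over the ordered y with
   M_i exp(c_i) <= M_(i+1) for all i: a strict inequality would allow node i to be
   pushed further to the right.  The weight hypothesis on J guarantees that for
   ordered nodes not all M_j vanish. *)
Require Import Defs.
From HB Require Import structures.
From mathcomp Require Import all_boot all_order all_algebra.
From mathcomp Require Import all_classical all_reals all_analysis.
From mathcomp Require Import ring lra.
Set Implicit Arguments. Unset Strict Implicit. Unset Printing Implicit Defensive.
Import Order.TTheory GRing.Theory Num.Theory.
Import numFieldNormedType.Exports.
Local Open Scope classical_set_scope.
Local Open Scope ring_scope.

(** The field J is only bounded above, so the suprema m_j need be neither attained nor
    differentiable in the nodes. Every comparison is therefore made pointwise, often only at points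
    where a product reaches half of its supremum. Exponentials turn -oo into 0, which keeps each M_j
    finite and continuous even where nodes collide or reach the ends; the compactness arguments take
    place there, while logarithms are used only where all M_j are positive. Cutting each exp K_i
    into its two branches makes the product belonging to one interval vanish off that interval, so
    that all suprema run over the fixed set [0, 1]. The end condition enters because (PM_0) compares
    K_i at points one period apart: near-maximisers of M_0 and M_n at distance close to 1 would
    leave no room for the gain from strict concavity. Since a kernel may tend to -oo at -1 or 1, a
    node at one end can also kill the opposite end; the half weights of 0 and 1 account for this. *)

Section ConcaveSlopes.
Variable R : realType.
Implicit Types (f : R -> R) (a b c d x y u v : R).

(** * Chord slopes of concave functions *)

Definition slope f x y : R := (f y - f x) / (y - x).

Lemma slopeM f x y : x < y -> f y - f x = slope f x y * (y - x).
Proof. by move=> xy; rewrite /slope divfK// subr_eq0 gt_eqF. Qed.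

Lemma concave_on_opp a b f : concave_on [set` `]a, b[] f ->
  concave_on [set` `](- b), (- a)[] (f \o -%R).
Proof.
move=> cf x y l /=; rewrite !in_itv/= => xI yI l01.
have := cf (- x) (- y) l; rewrite /= !in_itv/=.
have -> : l * - x + (1 - l) * - y = - (l * x + (1 - l) * y) by ring.
by apply => //; apply/andP; lra.
Qed.

Lemma strictly_concave_onW (I : set R) f :
  strictly_concave_on I f -> concave_on I f.
Proof.
move=> cf x y l Ix Iy /andP[l0 l1].
have [->|xy] := eqVneq x y; first by rewrite -!mulrDl subrKC !mul1r.
have [->|ln0] := eqVneq l 0; first by rewrite !mul0r !add0r subr0 !mul1r.
have [->|ln1] := eqVneq l 1; first by rewrite subrr !mul0r !addr0 !mul1r.
by apply/ltW/cf => //; rewrite !lt_neqAle l0 l1 eq_sym ln0 ln1.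
Qed.

Section slopes.
Variables (a b : R) (f : R -> R).
Hypothesis cf : concave_on [set` `]a, b[] f.

Let mid x y z : a < x -> x < y -> y < z -> z < b ->
  (z - y) * f x + (y - x) * f z <= (z - x) * f y.
Proof.
move=> ax xy yz zb; have zx : 0 < z - x by lra.
have := @cf x z ((z - y) / (z - x)).
rewrite /= !in_itv/= ler_pdivrMr// divr_ge0 ?mul1r; [|lra..].
have -> : 1 - (z - y) / (z - x) = (y - x) / (z - x) by field; lra.
have -> : (z - y) / (z - x) * x + (y - x) / (z - x) * z = y by field; lra.
have -> : (z - y) / (z - x) * f x + (y - x) / (z - x) * f z =
  ((z - y) * f x + (y - x) * f z) / (z - x) by field; lra.
by rewrite ler_pdivrMr// (mulrC (f y)); apply; apply/andP; lra.
Qed.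

(** The ends of the chord move to the right one at a time, through the chord from [x] to [v]; the
    two intervals may overlap. *)
Lemma concave_slope_le x y u v : a < x -> x < y -> x <= u -> u < v -> y <= v ->
  v < b -> slope f u v <= slope f x y.
Proof.
move=> ax xy xu uv yv vb.
have h1 : slope f x v <= slope f x y.
  move: yv; rewrite le_eqVlt => /predU1P[->//|yv].
  rewrite /slope ler_pdivrMr ?subr_gt0; last lra.
  rewrite mulrAC ler_pdivlMr ?subr_gt0//.
  by have := mid ax xy yv vb; nra.
apply: le_trans h1; move: xu; rewrite le_eqVlt => /predU1P[->//|xu].
rewrite /slope ler_pdivrMr ?subr_gt0//.
rewrite mulrAC ler_pdivlMr ?subr_gt0; last lra.
by have := mid ax xu uv vb; nra.
Qed.

Lemma concave_lipschitz c d : a < c -> c <= d -> d < b ->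
  exists2 L, 0 < L & forall p q, c <= p <= d -> c <= q <= d ->
    `|f p - f q| <= L * `|p - q|.
Proof.
(* Chords just outside [[c, d]] bound all slopes inside it from above and from below. *)
move=> ac cd db; set A := slope f ((a + c) / 2) c.
set B := slope f d ((d + b) / 2).
exists (1 + `|A| + `|B|); first by rewrite !ltr_pwDl.
have main p q : p < q -> c <= p <= d -> c <= q <= d ->
    `|f p - f q| <= (1 + `|A| + `|B|) * `|p - q|.
  move=> pq /andP[cp pd] /andP[cq qd].
  have h1 : slope f p q <= A by apply: concave_slope_le; lra.
  have h2 : B <= slope f p q by apply: concave_slope_le; lra.
  rewrite distrC (slopeM _ pq) normrM (distrC p).
  apply: ler_wpM2r => //; rewrite ler_norml.
  have := ler_norm A; have := ler_norm (- B); rewrite normrN.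
  have := normr_ge0 A; have := normr_ge0 B.
  by move=> *; apply/andP; split; lra.
move=> p q pI qI; have [pq|qp|->] := ltgtP p q; first exact: main.
  by rewrite distrC (distrC p); exact: main.
by rewrite !subrr normr0 mulr0.
Qed.

Lemma concave_continuous x : a < x < b -> f @ x --> f x.
Proof.
move=> /andP[ax xb].
have [|||L L0 fL] := @concave_lipschitz ((a + x) / 2) ((x + b) / 2); [lra..|].
apply/cvgrPdist_le => e e0.
have Le : 0 < L^-1 * e by rewrite mulr_gt0// invr_gt0.
near=> t.
have t1 : (a + x) / 2 < t by near: t; apply: lt_nbhsr; lra.
have t2 : t < (x + b) / 2 by near: t; apply: lt_nbhsl; lra.
have xt : `|x - t| <= L^-1 * e by near: t; exact: cvgr_dist_le.
apply: le_trans (fL x t _ _) _; [lra..|].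
by rewrite -ler_pdivlMl.
Unshelve. all: by end_near. Qed.

End slopes.

Lemma strictly_concave_slope_lt a b f x y u v :
  strictly_concave_on [set` `]a, b[] f ->
  a < x -> x < y -> y <= u -> u < v -> v < b -> slope f u v < slope f x y.
Proof.
move=> sf ax xy yu uv vb; have cf := strictly_concave_onW sf.
(* Strictness is gained on the right half [[z, y]] of the first interval; the rest is weak
   monotonicity. *)
set z := (x + y) / 2; have [xz zy] : x < z /\ z < y by rewrite /z; lra.
apply: (@le_lt_trans _ _ (slope f z y)).
  by apply: (concave_slope_le cf) => //; lra.
have := @sf x y 2^-1.
rewrite /= !in_itv/= invr_gt0 invf_lt1 ?ltr0n// ltr1n.
have -> : 2^-1 * x + (1 - 2^-1) * y = z by rewrite /z; field.
move=> h; have {}h : 2^-1 * f x + (1 - 2^-1) * f y < f z.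
  by apply: h => //; [apply/andP; lra..|rewrite lt_eqF].
rewrite /slope ltr_pdivrMr ?subr_gt0// mulrAC ltr_pdivlMr ?subr_gt0//.
by rewrite /z in h *; nra.
Qed.

End ConcaveSlopes.

(** * Differentiability of concave functions outside a countable set *)

Section ConcaveDerivable.
Variable R : realType.
Implicit Types (f : R -> R) (a b t : R).

Lemma dnbhs0_itv (d e : R) : 0 < d -> 0 < e ->
  \forall h \near 0^', h != 0 /\ - d < h < e.
Proof.
move=> d0 e0; near=> h; split; first by near: h; exact: nbhs_dnbhs_neq.
have hm : `|h| < Num.min d e by near: h; apply: dnbhs0_lt; rewrite lt_min d0.
move: hm; rewrite lt_min => /andP[/ltr_normlP[h1 _] /ltr_normlP[_ h2]].
by apply/andP; lra.
Unshelve. all: by end_near. Qed.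

Lemma countable_negligible (N : set R) : countable N ->
  (@lebesgue_measure R).-negligible N.
Proof.
move=> cN; apply/negligibleP; last exact: countable_lebesgue_measure0.
by apply: countable_measurable => // t; exact: measurable_set1.
Qed.

Lemma countable_shift (N : set R) (c : R) : countable N ->
  countable [set t | N (t + c)].
Proof.
move=> /countable_injP[g ginj]; apply/countable_injP.
exists (fun t => g (t + c)) => x y /set_mem/= Nx /set_mem/= Ny.
by move=> /(ginj _ _ (mem_set Nx) (mem_set Ny)) /addIr.
Qed.

Section interval.
Variables (a b : R) (f : R -> R).
Hypothesis cf : concave_on [set` `]a, b[] f.

(** A rational between the one-sided derivatives. One inequality is strict so that [s < t] cannot
    share [q]: the slope from [s] to [t] would be both at most [q] and above it. *)
Let gap t (q : rat) := (forall s, t < s < b -> slope f t s <= ratr q) /\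
  (forall s, a < s < t -> ratr q < slope f s t).

Let quotient_slope t (h : R) : 0 < h ->
  h^-1 *: ((f \o shift t) (h *: 1) - f t) = slope f t (t + h).
Proof.
by move=> h0; rewrite /slope /= [h *: 1]mulr1 [t + h]addrC addrK mulrC.
Qed.

Let quotient_slopeN t (h : R) : h < 0 ->
  h^-1 *: ((f \o shift t) (h *: 1) - f t) = slope f (t + h) t.
Proof.
move=> h0; rewrite /slope /= [h *: 1]mulr1 [t + h]addrC opprD [- h - t]addrC.
by rewrite addrA subrr add0r invrN mulrN -mulNr opprB mulrC.
Qed.

(** The candidate derivative is the supremum [d] of the right slopes, a lower bound of the left
    ones. Were all left slopes at least [d + e], a rational strictly between [d] and [d + e] would
    form a gap. *)
Let derivable_of_no_gap t : a < t < b -> (forall q, ~ gap t q) ->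
  derivable f t 1.
Proof.
move=> /andP[at_ tb] nogap.
set A := [set slope f t s | s in `]t, b[].
set d := sup A.
have A0 : A !=set0 by exists (slope f t ((t + b) / 2)), ((t + b) / 2) => //=;
  rewrite in_itv/=; apply/andP; lra.
have Aub s : a < s < t -> ubound A (slope f s t).
  move=> /andP[as_ st] _ [u /= + <-]; rewrite in_itv/= => /andP[tu ub].
  by apply: (concave_slope_le cf); lra.
have hA : has_sup A.
  by split => //; exists (slope f ((a + t) / 2) t); apply: Aub; apply/andP; lra.
have dA s : t < s < b -> slope f t s <= d.
  by move=> sI; apply: sup_ubound; [exact: hA.2|exists s].
have Ad s : a < s < t -> d <= slope f s t.
  by move=> sI; apply: ge_sup => //; exact: Aub.
apply/cvg_ex; exists d; apply/cvgrPdist_le => e e0.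
have [s1 s1I s1d] : exists2 s, t < s < b & d - e < slope f t s.
  have [_ [s /= sI <-] ds] := sup_adherent e0 hA.
  by exists s => //; move: sI; rewrite in_itv.
have [s2 s2I s2d] : exists2 s, a < s < t & slope f s t < d + e.
  apply: contrapT => h.
  have [q] : exists q : rat, ratr q \in `]d, (d + e)[.
    by apply: rat_in_itvoo; rewrite ltrDl.
  rewrite in_itv/= => /andP[dq qe].
  apply: (nogap q); split=> [s /dA /le_trans -> //|s sI]; first exact: ltW.
  apply: (lt_le_trans qe); rewrite leNgt; apply/negP => hs; apply: h.
  by exists s.
move: s1I s2I => /andP[ts1 s1b] /andP[as2 s2t].
near=> h.
have [h0 /andP[h2 h1]] : h != 0 /\ - (t - s2) < h < s1 - t.
  by near: h; apply: dnbhs0_itv; rewrite subr_gt0.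
move: h0; rewrite neq_lt => /orP[hn|hp].
  rewrite quotient_slopeN//.
  have := Ad (t + h); have := @concave_slope_le _ _ _ _ cf s2 t (t + h) t.
  move=> h3 h4; rewrite ler_norml; apply/andP; split.
    by have := h3 as2 s2t; lra.
  by have := h4 ltac:(apply/andP; lra); lra.
rewrite quotient_slope//.
have := dA (t + h); have := @concave_slope_le _ _ _ _ cf t (t + h) t s1.
move=> h3 h4; rewrite ler_norml; apply/andP; split.
  by have := h4 ltac:(apply/andP; lra); lra.
by have := h3 at_; lra.
Unshelve. all: by end_near. Qed.

(* At a point of non-derivability some rational separates the right slopes from
   the left ones, and a rational does so at no more than one point. *)
Lemma concave_countable_nonderivable :
  countable [set t | a < t < b /\ ~ derivable f t 1].
Proof.
set N := [set t | _].
have Ngap t : t \in N -> exists q, gap t q.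
  move=> /set_mem[tI nd]; apply: contrapT => h; apply: nd.
  by apply: derivable_of_no_gap => // q gq; apply: h; exists q.
pose g t := xget (0%R : rat) [set q | gap t q].
have gP t : t \in N -> gap t (g t).
  by move=> /Ngap[q gq]; rewrite /g; case: xgetP => [q' -> //|/(_ q)].
have ginj s t : s \in N -> t \in N -> s < t -> g s != g t.
  move=> Ns Nt st; apply/eqP => gst.
  have /set_mem[/andP[as_ sb] _] := Ns; have /set_mem[/andP[at_ tb] _] := Nt.
  have := (gP _ Ns).1 t; have := (gP _ Nt).2 s.
  by rewrite gst st as_ tb /= => /(_ isT) + /(_ isT); lra.
apply/countable_injP; exists (pickle \o g) => s t Ns Nt /= /(pcan_inj pickleK).
move=> gst; have [st|ts|//] := ltgtP s t.
- by have := ginj _ _ Ns Nt st; rewrite gst eqxx.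
- by have := ginj _ _ Nt Ns ts; rewrite gst eqxx.
Qed.

Lemma slope_le_derive1 t s : a < t -> t < s -> s < b -> derivable f t 1 ->
  slope f t s <= derive1 f t.
Proof.
move=> at_ ts sb df; rewrite derive1E; apply: limr_ge => //; near=> h.
have [h0 /andP[h2 h1]] : h != 0 /\ - (t - a) < h < s - t.
  by near: h; apply: dnbhs0_itv; rewrite subr_gt0.
move: h0; rewrite neq_lt => /orP[hn|hp].
  by rewrite quotient_slopeN//; apply: (concave_slope_le cf); lra.
by rewrite quotient_slope//; apply: (concave_slope_le cf); lra.
Unshelve. all: by end_near. Qed.

Lemma derive1_le_slope t s : a < s -> s < t -> t < b -> derivable f t 1 ->
  derive1 f t <= slope f s t.
Proof.
move=> as_ st tb df; rewrite derive1E; apply: limr_le => //; near=> h.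
have [h0 /andP[h2 h1]] : h != 0 /\ - (t - s) < h < b - t.
  by near: h; apply: dnbhs0_itv; rewrite subr_gt0.
move: h0; rewrite neq_lt => /orP[hn|hp].
  by rewrite quotient_slopeN//; apply: (concave_slope_le cf); lra.
by rewrite quotient_slope//; apply: (concave_slope_le cf); lra.
Unshelve. all: by end_near. Qed.

End interval.

Lemma negligible_itv_ex (N : set R) u v : (@lebesgue_measure R).-negligible N ->
  u < v -> exists2 t, u < t < v & ~ N t.
Proof.
move=> [A [mA A0 NA]] uv; apply: contrapT => h.
have sub : `]u, v[%classic `<=` A.
  move=> t /=; rewrite in_itv/= => tI; apply: NA; apply: contrapT => Nt.
  by apply: h; exists t.
have : (lebesgue_measure `]u, v[%classic <= lebesgue_measure A)%E.
  by apply: le_measure => //; rewrite inE.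
rewrite A0 lebesgue_measure_itv/= lte_fin uv -EFinB lee_fin; lra.
Qed.

End ConcaveDerivable.

(** * From (PM_0) almost everywhere to an inequality between increments *)

Section PeriodicMonotone.
Variables (R : realType) (K : R -> \bar R).
Let f := fun s => fine (K s).
Hypothesis cl : concave_on [set` `](-1), 0[] f.
Hypothesis cr : concave_on [set` `]0, 1[] f.
Hypothesis pm : PM 0 K.

(** The room between [q] and [r] allows a choice of [t] outside a null set, with [f] differentiable
    at [t] and at [t - 1]; the two derivatives separate the two slopes. *)
Let slope_shift (p q r s : R) : 0 < p -> p < q -> q < r -> r < s -> s < 1 ->
  slope f (r - 1) (s - 1) <= slope f p q.
Proof.
move=> p0 pq qr rs s1.
set N1 := [set t : R | 0 < t < 1 /\ ~ derivable f t 1].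
set N0 := [set t : R | - 1 < t < 0 /\ ~ derivable f t 1].
set N2 := [set t : R | N0 (t - 1)].
have N1n : (@lebesgue_measure R).-negligible N1.
  have c1 : countable N1 := concave_countable_nonderivable cr.
  exact: countable_negligible.
have N2n : (@lebesgue_measure R).-negligible N2.
  have c2 : countable N0 := concave_countable_nonderivable cl.
  exact: countable_negligible (countable_shift _ c2).
have [t /andP[qt tr]] := negligible_itv_ex (negligibleU pm
  (negligibleU N1n N2n)) qr.
move=> /not_orP[/contrapT + /not_orP[n1 n2]].
have d1 : derivable f t 1.
  by apply: contrapT => nd; apply: n1; split => //; apply/andP; lra.
have d2 : derivable f (t - 1) 1.
  by apply: contrapT => nd; apply: n2; refine (conj _ nd); apply/andP; lra.
move=> /(_ _ d1 d2); rewrite in_itv/= => /(_ ltac:(apply/andP; lra)) h.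
have h1 : derive1 f t <= slope f q t by apply: (derive1_le_slope cr) => //; lra.
have h2 : slope f q t <= slope f p q by apply: (concave_slope_le cr); lra.
have h3 : slope f (t - 1) (r - 1) <= derive1 f (t - 1).
  by apply: (slope_le_derive1 cl) => //; lra.
have h4 : slope f (r - 1) (s - 1) <= slope f (t - 1) (r - 1).
  by apply: (concave_slope_le cl); lra.
by rewrite -/f in h; lra.
Qed.

(* Riemann sums of slopes over meshes of size (v - u) / N: the shift by two
   cells disappears in the limit. *)
Lemma PM_increment_le (u v : R) : 0 < u -> u <= v -> v < 1 ->
  f (v - 1) - f (u - 1) <= f v - f u.
Proof.
move=> u0; rewrite le_eqVlt => /predU1P[->|uv] v1; first by rewrite !subrr.
apply/ler_addgt0Pr => e e0.
have cu : f @ (u - 1) --> f (u - 1).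
  by apply: (concave_continuous cl); apply/andP; lra.
have cv : f @ (v - 1) --> f (v - 1).
  by apply: (concave_continuous cl); apply/andP; lra.
have e20 : 0 < e / 2 by lra.
have /cvgrPdist_lt /(_ _ e20) [d1 /= d10 hd1] := cu.
have /cvgrPdist_lt /(_ _ e20) [d2 /= d20 hd2] := cv.
(* Below both continuity radii, and below [1 - v] so that the mesh shifted by two cells stays left
   of 1. *)
pose d := Num.min (Num.min d1 d2) (1 - v).
have d0 : 0 < d by rewrite !lt_min d10 d20/= subr_gt0.
have [N Nd] : exists N : nat, 2 * (v - u) / d < N.+1%:R.
  exists (Num.bound (2 * (v - u) / d)).
  apply: lt_trans (archi_boundP _) _; last by rewrite ltr_nat.
  by rewrite divr_ge0 ?ltW// mulr_gt0// subr_gt0.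
set h := (v - u) / N.+1%:R.
have h0 : 0 < h by rewrite divr_gt0// subr_gt0.
have hd : 2 * h < d.
  by move: Nd; rewrite ltr_pdivrMr// /h mulrA ltr_pdivrMr// => /lt_le_trans ->//; rewrite mulrC.
have dd1 : d <= d1 by rewrite /d !ge_min lexx.
have dd2 : d <= d2 by rewrite /d !ge_min lexx orbT.
have dv : d <= 1 - v by rewrite /d !ge_min lexx orbT.
pose p k := u + k%:R * h.
have pS k : p k.+1 = p k + h by rewrite /p -natr1; ring.
have pN : p N.+1 = v by rewrite /p /h mulrC divfK ?pnatr_eq0// subrKC.
(* Shifting by [2 * h] instead of [h] leaves one whole cell free, which is the room [slope_shift]
   asks for. *)
have step k : (k <= N)%N ->
    f (p k.+1 + 2 * h - 1) - f (p k + 2 * h - 1) <= f (p k.+1) - f (p k).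
  move=> kN.
  have p0 : u <= p k by rewrite /p lerDl mulr_ge0// ltW.
  have p1 : p k.+1 <= v.
    by rewrite -pN /p lerD2l ler_wpM2r ?(ltW h0)// ler_nat ltnS.
  have hp : p k.+1 - p k = h by rewrite pS; ring.
  rewrite [leRHS]slopeM ?[leLHS]slopeM; [|lra..].
  have -> : p k.+1 + 2 * h - 1 - (p k + 2 * h - 1) = h by rewrite -hp; ring.
  rewrite hp; apply: ler_wpM2r; first exact: ltW.
  have := @slope_shift (p k) (p k.+1) (p k + 2 * h) (p k.+1 + 2 * h).
  by apply; lra.
have sum k : (k <= N.+1)%N ->
    f (p k + 2 * h - 1) - f (p 0%N + 2 * h - 1) <= f (p k) - f (p 0%N).
  elim: k => [_|k IH kN]; first by rewrite !subrr.
  by have := IH (ltnW kN); have := step k kN; lra.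
have := sum N.+1 (leqnn _); rewrite pN {1 2}/p mul0r addr0 => S.
have := hd1 (u + 2 * h - 1); have := hd2 (v + 2 * h - 1).
rewrite /ball_/=.
have -> : v - 1 - (v + 2 * h - 1) = - (2 * h) by ring.
have -> : u - 1 - (u + 2 * h - 1) = - (2 * h) by ring.
rewrite normrN gtr0_norm; last lra.
move=> /(_ ltac:(lra)) /ltr_normlP[a1 a2] /(_ ltac:(lra)) /ltr_normlP[a3 a4].
by lra.
Qed.
End PeriodicMonotone.

(** * A quantitative form of strict concavity *)

Section StrictGain.
Variables (R : realType) (a b : R) (f : R -> R).
Hypothesis sf : strictly_concave_on [set` `]a, b[] f.
Let cf := strictly_concave_onW sf.

Let slope_continuous (u v x : R) : a < x + u -> u < v -> x + v < b ->
  (fun p => slope f (p + u) (p + v)) @ x --> slope f (x + u) (x + v).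
Proof.
move=> au uv vb; rewrite /slope.
have shiftc (w : R) : a < x + w < b -> (fun p => f (p + w)) @ x --> f (x + w).
  move=> xw; apply: (@cvg_comp _ _ _ (fun p => p + w) f _ (nbhs (x + w))).
    by apply: cvgD; [exact: cvg_id|exact: cvg_cst].
  exact: (concave_continuous cf).
apply: cvgM.
  by apply: cvgB; apply: shiftc; apply/andP; lra.
have -> : (fun p : R => (p + v - (p + u))^-1) = (fun=> (x + v - (x + u))^-1).
  by apply/funext => p; congr (_^-1); ring.
exact: cvg_cst.
Qed.

(* The left increment exceeds the shifted one by an amount comparable to its
   length: for increments shorter than delta / 2 compare both with the slopes
   over two fixed disjoint cells, whose gap is bounded below by compactness. *)
Lemma strict_concave_gain (delta : R) : 0 < delta -> exists2 eta, 0 < eta &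
  forall p q tau, a + delta <= p -> p <= q -> delta <= tau ->
    q + tau <= b - delta ->
    f (q + tau) - f (p + tau) + eta * (q - p) <= f q - f p.
Proof.
move=> d0; set d := delta.
(* If [[a + d, b - 2 * d]] is empty, no [p], [q], [tau] satisfy the hypotheses and any rate will
   do. *)
have [small|big] := ltP (b - 2 * d) (a + d).
  by exists 1 => // p q t *; exfalso; rewrite -/d in d0 *; lra.
(* A chord from [p] of length at most [d / 2] lies left of the first cell, and its shift by at least
   [d] lies right of the second; the cells are disjoint, which makes [phi] positive. *)
pose phi p := slope f (p + d / 2) (p + 5 / 8 * d)
  - slope f (p + 7 / 8 * d) (p + d).
have [c cI phic] : exists2 c, c \in `[a + d, b - 2 * d] &
    forall t, t \in `[a + d, b - 2 * d] -> phi c <= phi t.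
  apply: EVT_min => //; apply: continuous_in_subspaceT => x.
  rewrite inE/= in_itv/= => /andP[x1 x2].
  by apply: cvgB; apply: slope_continuous; rewrite -/d in d0 *; lra.
have phi0 : 0 < phi c.
  move: cI; rewrite in_itv/= => /andP[c1 c2]; rewrite subr_gt0.
  by apply: (strictly_concave_slope_lt sf); rewrite -/d in d0 *; lra.
exists (phi c) => // p q t ap pq dt tb.
have short (x y : R) : a + d <= x -> x < y -> y <= x + d / 2 ->
    y + t <= b - d -> f (y + t) - f (x + t) + phi c * (y - x) <= f y - f x.
  move=> ax xy yx yb.
  have dd : 0 < d by [].
  have xI : x \in `[a + d, b - 2 * d] by rewrite in_itv/=; apply/andP; lra.
  have h1 : slope f (x + d / 2) (x + 5 / 8 * d) <= slope f x y.
    by apply: (concave_slope_le cf); lra.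
  have h2 : slope f (x + t) (y + t) <= slope f (x + 7 / 8 * d) (x + d).
    by apply: (concave_slope_le cf); lra.
  have h3 := phic _ xI; rewrite {2}/phi in h3.
  rewrite !slopeM//; last lra.
  have -> : y + t - (x + t) = y - x by ring.
  by rewrite -mulrDl ler_wpM2r//; lra.
(* Long increments are peeled off from the right in pieces of length [d / 2], over which the gains
   add up. *)
have main (m : nat) (y : R) : p <= y -> y + t <= b - d ->
    y - p <= m%:R * (d / 2) ->
    f (y + t) - f (p + t) + phi c * (y - p) <= f y - f p.
  elim: m y => [|m IH] y py yb.
    rewrite mul0r subr_le0 => yp; have -> : y = p by apply/eqP; rewrite eq_le yp.
    by rewrite !subrr mulr0 addr0.
  rewrite -natr1 mulrDl mul1r => ym.
  have [yp|yp] := leP y (p + d / 2).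
    move: py; rewrite le_eqVlt => /predU1P[<-|py].
      by rewrite !subrr mulr0 addr0.
    exact: short.
  have dd : 0 < d by [].
  have := IH (y - d / 2) ltac:(lra) ltac:(lra) ltac:(lra).
  have := short (y - d / 2) y ltac:(lra) ltac:(lra) ltac:(lra) yb.
  by lra.
apply: (main (Num.bound ((q - p) / (d / 2)))) => //.
rewrite -ler_pdivrMr; last by rewrite divr_gt0.
by apply/ltW/archi_boundP; rewrite divr_ge0 ?subr_ge0// divr_ge0 ?ltW.
Qed.

End StrictGain.

(** * Exponentials of single kernel branches *)

Section HalfKernel.
Variable R : realType.

(* The exponential of one branch of a singular kernel, reflected to the right
   half-line if necessary and extended by 0 on the left and by its limit at 1
   on the right. *)
Record half_kernel (k : R -> R) : Prop := HalfKernel {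
  hk_ucont : forall e, 0 < e -> exists2 d, 0 < d &
    forall s t, `|s - t| < d -> `|k s - k t| <= e;
  hk_le0 : forall s, s <= 0 -> k s = 0;
  hk_gt0 : forall s, 0 < s < 1 -> 0 < k s;
  hk_bound : exists2 B, 0 < B & forall s, k s <= B;
  hk_ge0 : forall s, 0 <= k s;
  hk_tp : forall p q h, p <= q -> 0 <= h -> q + h <= 1 ->
    k p * k (q + h) <= k (p + h) * k q;
  hk_lip : forall d, 0 < d -> exists2 L, 0 < L &
    forall s t, d <= s <= 1 - d -> d <= t <= 1 - d ->
      k s <= k t * expR (L * `|s - t|) }.

(** Clamping to [[a, b]] is 1-Lipschitz and does not change [k], so a uniform radius found on the
    compact segment serves the whole line. *)
Lemma ucont_of_clamped (k : R -> R) (a b : R) : a <= b -> continuous k ->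
  (forall s, s <= a -> k s = k a) -> (forall s, b <= s -> k s = k b) ->
  forall e : R, 0 < e -> exists2 d : R, 0 < d &
    forall s t, `|s - t| < d -> `|k s - k t| <= e.
Proof.
move=> ab ck ka kb e e0.
have cover x : [set` `[a, b]] x -> \forall x' \near x & d \near 0^'+,
    forall t, `|x' - t| < d -> `|k x' - k t| <= e.
  move=> _; have /cvgrPdist_lt /(_ (e / 2)) := ck x.
  rewrite divr_gt0// => /(_ isT) [r /= r0 hr].
  near=> x' d => /= t xt.
  have h1 : `|x - x'| < r / 2.
    by near: x'; apply: cvgr_dist_lt; [exact: cvg_id|rewrite divr_gt0].
  have h2 : d < r / 2.
    by near: d; apply: nbhs_right_lt; rewrite divr_gt0.
  have h3 : `|k x - k x'| < e / 2 by apply: hr => /=; lra.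
  have h4 : `|k x - k t| < e / 2.
    apply: hr => /=; apply: (le_lt_trans (ler_distD x' _ _)).
    by rewrite (splitr r) ltrD// (lt_trans xt).
  apply: (le_trans (ler_distD (k x) _ _)).
  by rewrite (splitr e) lerD ?ltW// distrC.
have [segc _] := compact_near_coveringP `[a, b]%classic.
have hseg : \forall d \near (0 : R)^'+, `[a, b]%classic `<=`
    (fun x => forall t, `|x - t| < d -> `|k x - k t| <= e).
  exact: (segc (@segment_compact R a b) R (0^'+)
    (fun d x => forall t, `|x - t| < d -> `|k x - k t| <= e)).
have hpos : \forall d \near (0 : R)^'+, 0 < d by exact: nbhs_right_gt.
have [d [/= d0 hd]] := filter_ex (filterI hpos hseg).
pose clamp (s : R) := Num.max a (Num.min s b).
have kc s : k s = k (clamp s).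
  rewrite /clamp; have [sb|bs] := leP s b.
    by have [as_|sa] := leP a s => //; exact/ka/ltW.
  by rewrite max_r// kb// ltW.
have clampI s : clamp s \in `[a, b].
  by rewrite in_itv/= /clamp le_max lexx/= ge_max ab ge_min lexx orbT.
have clamp1 s t : `|clamp s - clamp t| <= `|s - t|.
  wlog st : s t / s <= t.
    move=> W; have [/W//|/ltW/W] := leP s t.
    by rewrite distrC (distrC t).
  rewrite distrC (distrC s) !ger0_norm ?subr_ge0//; last first.
    by rewrite /clamp ge_max le_max lexx/= le_max le_min !ge_min st lexx !orbT.
  rewrite /clamp; have [] := leP t b; have [] := leP s b;
  rewrite ?(max_r ab); have [] := leP a s; have [] := leP a t; lra.
exists d => // s t st; rewrite (kc s) (kc t).
by apply: hd; [exact: clampI|exact: le_lt_trans st].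
Unshelve. all: by end_near. Qed.


Lemma half_kernel_of_concave (f k : R -> R) :
  concave_on [set` `]0, 1[] f -> (forall s, s <= 0 -> k s = 0) ->
  (forall s, 0 < s < 1 -> k s = expR (f s)) ->
  (forall s, 1 <= s -> k s = k 1) ->
  k @ 0^'+ --> (0 : R) -> k @ 1^'- --> k 1 -> half_kernel k.
Proof.
move=> cf k0 kf k1 kr kl.
have near_cst (F : set_system R) (FF : Filter F) (c : R) :
    (\forall s \near F, k s = c) -> k @ F --> c.
  exact: cvg_near_cst.
have ck : continuous k.
  move=> x; have [x0|x0|x0] := ltgtP x 0.
  - rewrite /continuous_at k0 ?(ltW x0)//; apply: near_cst; near=> s.
    by apply/k0/ltW; near: s; exact: lt_nbhsl.
  - have [x1|x1|x1] := ltgtP x 1.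
    + rewrite /continuous_at (kf x) ?x0//.
      have h : \forall s \near x, expR (f s) = k s.
        near=> s; rewrite kf//; apply/andP; split; near: s.
          exact: lt_nbhsr.
        exact: lt_nbhsl.
      apply: cvg_trans (near_eq_cvg h) _.
      apply: continuous_cvg; first exact: continuous_expR.
      by apply: (concave_continuous cf); rewrite x0.
    + rewrite /continuous_at k1 ?(ltW x1)//; apply: near_cst; near=> s.
      by apply/k1/ltW; near: s; exact: lt_nbhsr.
    + rewrite x1; apply/left_right_continuousP; split=> //.
      apply: near_cst; near=> s; apply: k1; apply: ltW; near: s.
      exact: nbhs_right_gt.
  - rewrite x0; apply/left_right_continuousP; rewrite k0//; split=> //.
    apply: near_cst; near=> s; apply: k0; apply: ltW; near: s.
    exact: nbhs_left_lt.
have kge0 s : 0 <= k s.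
  have pos t : 0 < t < 1 -> 0 <= k t by move=> /kf ->; exact: expR_ge0.
  have [s0|s0] := leP s 0; first by rewrite k0.
  have [s1|s1] := ltP s 1; first by apply: pos; rewrite s0.
  rewrite k1//; apply: (cvgr_to_ge kl); near=> t; apply: pos.
  by apply/andP; split; near: t; [exact: nbhs_left_gt|exact: nbhs_left_lt].
split=> //.
- apply: (@ucont_of_clamped _ 0 1) => //.
  by move=> s s0; rewrite !k0.
- by move=> s /kf ->; exact: expR_gt0.
- have [c _ kc] : exists2 c : R, c \in `[0, 1] &
      forall t, t \in `[0, 1] -> k t <= k c.
    by apply: EVT_max => //; exact: continuous_subspaceT.
  exists (k c + 1) => [|s]; first by rewrite ltr_wpDl.
  apply: ler_wpDr => //.
  have [s0|s0] := leP s 0; first by rewrite k0.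
  have [s1|s1] := leP s 1; first by apply: kc; rewrite in_itv/= (ltW s0).
  by rewrite k1 ?(ltW s1)//; apply: kc; rewrite in_itv/= ler01 lexx.
- move=> p q h pq h0 qh.
  have [p0|p0] := leP p 0; first by rewrite (k0 p)// mul0r mulr_ge0.
  move: pq h0; rewrite le_eqVlt => /predU1P[<-|pq]; first by rewrite mulrC.
  rewrite le_eqVlt => /predU1P[<-|h0]; first by rewrite !addr0.
  have lt1 h' : 0 < h' -> q + h' < 1 -> k p * k (q + h') <= k (p + h') * k q.
    move=> h'0 qh'.
    rewrite !kf; [|apply/andP; lra..].
    rewrite -!expRD ler_expR.
    have : slope f q (q + h') <= slope f p (p + h').
      by apply: (concave_slope_le cf); lra.
    have := @slopeM _ f q (q + h') ltac:(lra).
    have := @slopeM _ f p (p + h') ltac:(lra).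
    rewrite !(addrC _ h') !addrK => e1 e2 /(ler_wpM2r (ltW h'0)); lra.
  (* At [q + h = 1] the value of [k] is only a limit, so the inequality is obtained by letting the
     shift increase to [h]. *)
  move: qh; rewrite le_eqVlt => /predU1P[qh|]; last exact: lt1.
  have kD (c : R) : (fun h' => k (c + h')) @ h^'- --> k (c + h).
    apply: (@cvg_comp _ _ _ (fun h' => c + h') k _ (nbhs (c + h)));
      last exact: ck.
    apply: cvgD; first exact: cvg_cst.
    by apply: cvg_at_left_filter; exact: cvg_id.
  rewrite -subr_ge0.
  apply: (cvgr_to_ge (F := h^'-)
    (f := fun h' => k (p + h') * k q - k p * k (q + h'))).
    apply: cvgB; apply: cvgM; try exact: cvg_cst; exact: kD.
  near=> h'; rewrite subr_ge0; apply: lt1.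
    by near: h'; exact: nbhs_left_gt.
  by rewrite -qh ltrD2l; near: h'; exact: nbhs_left_lt.
- move=> d d0; have [d1|d1] := leP d (1 - d); last first.
    by exists 1 => // s t /andP[? ?]; exfalso; lra.
  have d10 : 1 - d < 1 by lra.
  have [L L0 fL] := concave_lipschitz cf d0 d1 d10.
  exists L => // s t sI tI; have := fL s t sI tI.
  move: sI tI => /andP[s0 s1] /andP[t0 t1] /ler_normlP[_ h].
  rewrite !kf; [|apply/andP; lra..].
  by rewrite -expRD ler_expR; lra.
Unshelve. all: by end_near. Qed.

End HalfKernel.

(** * Norm and balls in coordinates *)

Section RowNorm.
Variables (R : realType) (n : nat).
Implicit Types (x y : 'rV[R]_n).

Lemma row_norm_coord x i : `|x ord0 i| <= `|x|.
Proof.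
rewrite [leRHS]/Num.norm/= mx_normrE.
by apply: (le_bigmax _ (fun ij => `|x ij.1 ij.2|) (ord0, i)).
Qed.

Lemma row_norm_le x c : 0 <= c -> (forall i, `|x ord0 i| <= c) -> `|x| <= c.
Proof.
move=> c0 xc; rewrite [leLHS]/Num.norm/= mx_normrE.
by apply: bigmax_le => // -[i j] _ /=; rewrite ord1.
Qed.

Lemma row_ballP x y e : 0 < e ->
  ball x e y <-> forall i, `|x ord0 i - y ord0 i| < e.
Proof.
move=> e0; split=> [[_ xy] i|xy]; first exact: xy.
by split=> // i j; rewrite ord1; exact: xy.
Qed.

End RowNorm.

(** * Products of bounded factors *)

Section BoundedProducts.
Variables (R : realType) (I : finType).
Implicit Types (a b : I -> R) (B e : R).

Lemma prod_le_exp (P : pred I) a B : 1 <= B -> (forall i, 0 <= a i <= B) ->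
  \prod_(i | P i) a i <= B ^+ #|I|.
Proof.
move=> B1 aB; apply: (@le_trans _ _ (\prod_(i | P i) B)).
  by apply: ler_prod => i _; exact: aB.
rewrite prodr_const; apply: ler_weXn2l => //; exact: max_card.
Qed.

(** The factors are exchanged one at a time. Since [1 <= B], an exponent that is larger than
    necessary does no harm and keeps the induction uniform. *)
Lemma dist_prod_le a b B e : 1 <= B -> (forall i, 0 <= a i <= B) ->
  (forall i, 0 <= b i <= B) -> (forall i, `|a i - b i| <= e) ->
  `|\prod_i a i - \prod_i b i| <= #|I|%:R * B ^+ #|I| * e.
Proof.
move=> B1 aB bB ab.
have B0 : 0 <= B by exact: le_trans B1.
have e0 (i : I) : 0 <= e by exact: le_trans (ab i).
suff H (s : seq I) : 0 <= \prod_(i <- s) b i <= B ^+ size s /\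
    `|\prod_(i <- s) a i - \prod_(i <- s) b i| <= (size s)%:R * B ^+ size s * e.
  have [_] := H (index_enum I).
  have -> // : size (index_enum I) = #|I|.
  by rewrite -sum1_size -sum1_card; apply: eq_bigl.
elim: s => [|i s [/andP[IH0 IH1] IH2]].
  by rewrite !big_nil subrr normr0 mul0r mul0r expr0 lexx ler01.
rewrite !big_cons /=; have /andP[b0 b1] := bB i; have /andP[a0 a1] := aB i.
split; first by rewrite exprS mulr_ge0//= ler_pM.
set A := \prod_(_ <- _) _ in IH2 *; set Q := \prod_(_ <- _) _ in IH0 IH1 IH2 *.
have -> : a i * A - b i * Q = a i * (A - Q) + (a i - b i) * Q by ring.
apply: (le_trans (ler_normD _ _)); rewrite !normrM (ger0_norm a0) (ger0_norm IH0).
have h1 : a i * `|A - Q| <= B * ((size s)%:R * B ^+ size s * e) by exact: ler_pM.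
have h2 : `|a i - b i| * Q <= e * B ^+ size s by exact: ler_pM.
have h3 : e * B ^+ size s <= e * B ^+ (size s).+1.
  by rewrite ler_wpM2l ?(e0 i)// exprS ler_peMl// exprn_ge0.
apply: (le_trans (lerD h1 (le_trans h2 h3))).
by rewrite -natr1 exprS le_eqVlt; apply/orP; left; apply/eqP; ring.
Qed.

End BoundedProducts.

(** * The functions M_j and their continuity *)

Section Translates.
Variables (R : realType) (n : nat).

(* Exponential form of the data: [tw] is exp J, [tr i] and [tl i] are the right
   branch and the reflected left branch of exp K_i.  [t_exchange] combines (PM_0)
   with strict concavity, [t_end] encodes the alternative between the conditions
   at 0 and at 1, and [t_support] is all that is kept of the weight condition. *)
Record translates := Translates {
  tw : R -> R;
  tr : 'I_n -> R -> R;
  tl : 'I_n -> R -> R;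
  tw_ge0 : forall t, 0 <= tw t;
  tw_bound : exists2 W, 0 < W & forall t, tw t <= W;
  tr_half : forall i, half_kernel (tr i);
  tl_half : forall i, half_kernel (tl i);
  t_exchange : forall i d, 0 < d -> exists2 eta, 0 < eta & forall a c h,
    d <= a -> 0 <= h -> a + h <= 1 - d -> c <= - d -> - 1 + d <= c - h ->
    d <= c - (a + h - 1) ->
    tr i a * tl i (- c) <= expR (- (eta * h)) * (tr i (a + h) * tl i (- (c - h)));
  t_end : (forall e, 0 < e -> exists2 d, 0 < d &
      forall t, 0 <= t <= 1 -> e <= tw t -> d <= t) \/
    (forall e, 0 < e -> exists2 d, 0 < d &
      forall t, 0 <= t <= 1 -> e <= tw t -> t <= 1 - d);
  t_support : forall y : 'rV[R]_n, (forall i, 0 <= y ord0 i <= 1) ->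
    exists t, [/\ 0 <= t <= 1, 0 < tw t &
      forall i, t != y ord0 i /\ `|t - y ord0 i| < 1] }.

Variable T : translates.
Implicit Types (y z : 'rV[R]_n) (j : nat) (i : 'I_n).

(** On interval [j] the nodes [i < j] lie to the left of [t], the others to the right. Each branch
    is 0 on the wrong side of its node, so [Hval j y] vanishes off the interval without mention of
    its end points. *)
Definition fac j i (u : R) : R := if (i < j)%N then tr T i u else tl T i (- u).

Definition Hval j y (t : R) : R := tw T t * \prod_i fac j i (t - y ord0 i).

Definition Mval j y : R := sup [set Hval j y t | t in `[0, 1]].

Lemma fac_ge0 j i u : 0 <= fac j i u.
Proof. by rewrite /fac; case: ifP => _; apply: hk_ge0; [exact: tr_half|exact: tl_half]. Qed.

Lemma Hval_ge0 j y t : 0 <= Hval j y t.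
Proof. by rewrite mulr_ge0 ?tw_ge0// prodr_ge0// => i _; exact: fac_ge0. Qed.

Let family_bound (k : 'I_n -> R -> R) : (forall i, half_kernel (k i)) ->
  exists2 B, 1 <= B & forall i u, k i u <= B.
Proof.
move=> hk; have /choice[b bP] i : exists b, 0 < b /\ forall u, k i u <= b.
  by have [b b0 kb] := hk_bound (hk i); exists b.
exists (1 + \sum_i b i) => [|i u].
  by rewrite lerDl sumr_ge0// => i _; rewrite ltW// (bP i).1.
apply: (le_trans ((bP i).2 u)); apply: ler_wpDl => //.
by rewrite (bigD1 i)//= lerDl sumr_ge0// => l _; rewrite ltW// (bP l).1.
Qed.

Lemma fac_bound : exists2 B, 1 <= B & forall j i u, 0 <= fac j i u <= B.
Proof.
have [B1 B11 hB1] := family_bound (tr_half T).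
have [B2 B21 hB2] := family_bound (tl_half T).
exists (Num.max B1 B2) => [|j i u]; first by rewrite le_max B11.
rewrite fac_ge0 /fac le_max; case: ifP => _; first by rewrite hB1.
by rewrite hB2 orbT.
Qed.

(** All other factors are bounded, so each single factor controls the product; a lower bound on
    [Hval] thus becomes one on every factor. The [W + 1] lets one constant serve both estimates. *)
Lemma Hval_le_fac : exists2 C, 0 < C &
  forall j y t, Hval j y t <= C * tw T t /\
    forall i, Hval j y t <= C * fac j i (t - y ord0 i).
Proof.
have [B B1 hB] := fac_bound; have [W W0 hW] := tw_bound T.
have B0 : 0 < B by exact: lt_le_trans B1.
exists ((W + 1) * B ^+ n) => [|j y t]; first by rewrite mulr_gt0 ?exprn_gt0// addr_gt0.
have W1 : 1 <= W + 1 by rewrite lerDr ltW.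
have P (Q : pred 'I_n) : \prod_(i | Q i) fac j i (t - y ord0 i) <= B ^+ n.
  by have := @prod_le_exp R 'I_n Q _ B B1 (fun i => hB j i (t - y ord0 i));
    rewrite card_ord.
split=> [|i].
  rewrite /Hval mulrC ler_wpM2r ?tw_ge0//; apply: (le_trans (P _)).
  by rewrite ler_peMl// exprn_ge0// ltW.
rewrite /Hval (bigD1 i)//= mulrCA mulrC ler_wpM2r ?fac_ge0//.
apply: ler_pM => //; [exact: tw_ge0| |].
  by apply: prodr_ge0 => k _; exact: fac_ge0.
by apply: (le_trans (hW t)); rewrite lerDl.
Qed.

Lemma Hval_bound : exists2 B, 0 < B & forall j y t, Hval j y t <= B.
Proof.
have [C C0 hC] := Hval_le_fac; have [W W0 hW] := tw_bound T.
exists (C * W) => [|j y t]; first exact: mulr_gt0.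
by apply: (le_trans (hC j y t).1); rewrite ler_pM2l.
Qed.

Lemma Hval_le_Mval j y t : 0 <= t <= 1 -> Hval j y t <= Mval j y.
Proof.
move=> tI; apply: sup_ubound; last by exists t => //=; rewrite in_itv.
by have [B _ hB] := Hval_bound; exists B => _ [s _ <-].
Qed.

Lemma Mval_le j y c : (forall t, 0 <= t <= 1 -> Hval j y t <= c) ->
  Mval j y <= c.
Proof.
move=> h; apply: ge_sup; first by exists (Hval j y 0), 0 => //=; rewrite in_itv/= lexx ler01.
by move=> _ [t + <-]; rewrite /= in_itv/=; exact: h.
Qed.

Lemma Mval_ge0 j y : 0 <= Mval j y.
Proof. by apply: le_trans (Hval_ge0 j y 0) (Hval_le_Mval _ _ _); rewrite lexx ler01. Qed.

Lemma Mval_bound : exists2 B, 0 < B & forall j y, Mval j y <= B.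
Proof.
by have [B B0 hB] := Hval_bound; exists B => // j y; apply: Mval_le.
Qed.

(** The supremum need not be attained, but points with at least half of it suffice, and by
    [Hval_away] these keep their distance from the nodes. *)
Lemma Mval_le_half j y c : 0 < Mval j y ->
  (forall t, 0 <= t <= 1 -> Mval j y / 2 <= Hval j y t -> Hval j y t <= c) ->
  Mval j y <= c.
Proof.
move=> M0 h; have [//|cM] := leP (Mval j y) c.
suff : Mval j y <= Num.max c (Mval j y / 2).
  by rewrite le_max => /orP[//|]; lra.
apply: Mval_le => t tI; rewrite le_max.
have [h1|h1] := leP (Mval j y / 2) (Hval j y t); first by rewrite h.
by rewrite (ltW h1) orbT.
Qed.

Lemma Mval_gt0_ex j y : 0 < Mval j y -> exists2 t, 0 <= t <= 1 & 0 < Hval j y t.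
Proof.
move=> M0; apply: contrapT => h.
have : Mval j y <= 0; last lra.
apply: Mval_le => t tI; rewrite leNgt; apply/negP => ht; apply: h.
by exists t.
Qed.

Lemma Hval_gt0 j y t : 0 < tw T t -> (forall i, 0 < fac j i (t - y ord0 i)) ->
  0 < Hval j y t.
Proof. by move=> w0 f0; rewrite mulr_gt0// prodr_gt0. Qed.

Lemma Hval_gt0_fac j y t : 0 < Hval j y t ->
  0 < tw T t /\ forall i, 0 < fac j i (t - y ord0 i).
Proof.
have [C C0 hC] := Hval_le_fac; have [hw hf] := hC j y t => H0; split=> [|i].
  by have := lt_le_trans H0 hw; rewrite pmulr_rgt0.
by have := lt_le_trans H0 (hf i); rewrite pmulr_rgt0.
Qed.

Lemma fac_gt0_side j i u : 0 < fac j i u ->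
  (if (i < j)%N then 0 < u else u < 0).
Proof.
rewrite /fac; case: ifP => _; rewrite ltNge => h; rewrite ltNge;
  apply: contra h => h.
  by rewrite (hk_le0 (tr_half T i)).
by rewrite (hk_le0 (tl_half T i)) ?oppr_le0.
Qed.

Let family_ucont (k : 'I_n -> R -> R) : (forall i, half_kernel (k i)) ->
  forall e, 0 < e -> exists2 d, 0 < d &
    forall i s t, `|s - t| < d -> `|k i s - k i t| <= e.
Proof.
move=> hk e e0.
have /choice[f fP] i : exists d, 0 < d /\ forall s t, `|s - t| < d ->
    `|k i s - k i t| <= e.
  by have [d d0 kd] := hk_ucont (hk i) e0; exists d.
exists (\big[Num.min/1]_i f i) => [|i s t].
  by apply: lt_bigmin => // i _; exact: (fP i).1.
by move=> st; apply: (fP i).2; apply: (lt_le_trans st); exact: bigmin_le.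
Qed.

Lemma fac_ucont e : 0 < e -> exists2 d, 0 < d &
  forall j i s t, `|s - t| < d -> `|fac j i s - fac j i t| <= e.
Proof.
move=> e0.
have [d1 d10 h1] := family_ucont (tr_half T) e0.
have [d2 d20 h2] := family_ucont (tl_half T) e0.
exists (Num.min d1 d2) => [|j i s t]; first by rewrite lt_min d10.
rewrite lt_min /fac => /andP[st1 st2]; case: ifP => _; first exact: h1.
by apply: h2; rewrite -opprD normrN.
Qed.

Lemma Mval_ucont e : 0 < e -> exists2 d, 0 < d & forall j y z,
  (forall i, `|y ord0 i - z ord0 i| < d) -> `|Mval j y - Mval j z| <= e.
Proof.
move=> e0; have [B B1 hB] := fac_bound; have [W W0 hW] := tw_bound T.
have B0 : 0 < B by exact: lt_le_trans B1.
(* The successor keeps [D] positive when [n = 0]. *)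
set D := W * (n.+1%:R * B ^+ n).
have D0 : 0 < D by rewrite !mulr_gt0// exprn_gt0.
have [d d0 hd] := fac_ucont (divr_gt0 e0 D0).
have main j y z : (forall i, `|y ord0 i - z ord0 i| < d) ->
    Mval j y <= Mval j z + e.
  move=> yz; apply: Mval_le => t tI.
  apply: (@le_trans _ _ (Hval j z t + e)); last by rewrite lerD2r Hval_le_Mval.
  rewrite -lerBlDl -mulrBr.
  have := @dist_prod_le R 'I_n (fun i => fac j i (t - y ord0 i))
    (fun i => fac j i (t - z ord0 i)) B (e / D) B1 (fun i => hB j i _)
    (fun i => hB j i _).
  rewrite card_ord => /(_ _)/(le_trans (ler_norm _)) h.
  apply: (@le_trans _ _ (W * (n%:R * B ^+ n * (e / D)))).
    apply: (@le_trans _ _ (tw T t * (n%:R * B ^+ n * (e / D)))).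
      apply: ler_wpM2l; first exact: tw_ge0.
      apply: h => i; apply: hd; have := yz i.
      have -> : t - y ord0 i - (t - z ord0 i) = - (y ord0 i - z ord0 i) by ring.
      by rewrite normrN.
    apply: ler_wpM2r => //.
    by rewrite !mulr_ge0// ?exprn_ge0 ?invr_ge0// ltW.
  have q0 : 0 < e / D by exact: divr_gt0.
  rewrite [leRHS](_ : e = D * (e / D)); last by rewrite mulrC divfK// gt_eqF.
  move: (e / D) q0 => q q0.
  rewrite /D -!mulrA ler_pM2l// !mulrA ler_wpM2r ?(ltW q0)//.
  by rewrite ler_wpM2r ?exprn_ge0 ?(ltW B0)// ler_nat.
exists d => // j y z yz; rewrite ler_norml.
have := main j y z yz; have := main j z y _.
by move=> /(_ (fun i => ltac:(rewrite distrC; exact: yz))) *; apply/andP; lra.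
Qed.

Lemma Mval_continuous j : continuous (Mval j).
Proof.
move=> y; apply/(@cvgrPdist_le _ _ _ _ (nbhs_filter y)) => e e0.
have [d d0 hd] := Mval_ucont e0.
have := nbhsx_ballx y d d0; apply: filterS => z yz.
by apply: hd; exact/(row_ballP _ _ d0).
Qed.

(** Each factor is then at least [e / C], while it vanishes at its node and is uniformly
    continuous. *)
Lemma Hval_away e : 0 < e -> exists2 d, 0 < d & forall j y t, e <= Hval j y t ->
  d <= tw T t /\
  forall i, if (i < j)%N then d <= t - y ord0 i else t - y ord0 i <= - d.
Proof.
move=> e0; have [C C0 hC] := Hval_le_fac.
(* Halved because uniform continuity gives a weak inequality, which has to contradict a lower bound
   of [e / C]. *)
have eC : 0 < e / C / 2 by rewrite !divr_gt0.
have [d d0 hd] := fac_ucont eC.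
exists (Num.min d (e / C)) => [|j y t eH]; first by rewrite lt_min d0 divr_gt0.
have [hw hf] := hC j y t; split=> [|i].
  by rewrite ge_min ler_pdivrMr// mulrC (le_trans eH hw) orbT.
have fi : e / C <= fac j i (t - y ord0 i).
  by rewrite ler_pdivrMr// mulrC (le_trans eH (hf i)).
have f0 : 0 < fac j i (t - y ord0 i) by apply: lt_le_trans fi; rewrite divr_gt0.
have fac0 : fac j i 0 = 0.
  rewrite /fac oppr0; case: ifP => _; apply: hk_le0 => //.
    exact: tr_half.
  exact: tl_half.
have far : d <= `|t - y ord0 i|.
  rewrite leNgt; apply/negP => lt_d.
  have := hd j i (t - y ord0 i) 0; rewrite subr0 => /(_ lt_d).
  rewrite fac0 subr0 gtr0_norm// => h.
  have : 0 < e / C by rewrite divr_gt0.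
  lra.
have := fac_gt0_side f0; case: ifP => _ side.
  by move: far; rewrite gtr0_norm// => far; rewrite ge_min far.
move: far; rewrite ltr0_norm// => far.
by rewrite lerNr ge_min far.
Qed.

End Translates.

(** * The two inequalities between products of maxima *)

Section Exchange.
Variables (R : realType) (n : nat) (T : translates R n).
Implicit Types (y z : 'rV[R]_n) (j : nat) (i : 'I_n).

(** For the left branch, reflection turns [p], [q] into [- (q + h)], [- (p + h)], and [- 1 <= p]
    becomes the upper bound required by [hk_tp]. *)
Lemma fac_tp j i p q h : - 1 <= p -> p <= q -> 0 <= h -> q + h <= 1 ->
  fac T j i p * fac T j i (q + h) <= fac T j i (p + h) * fac T j i q.
Proof.
move=> p1 pq h0 qh; rewrite /fac; case: ifP => _.
  exact: (hk_tp (tr_half T i)).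
have := @hk_tp _ _ (tl_half T i) (- (q + h)) (- (p + h)) h.
have -> : - (p + h) + h = - p by ring.
have -> : - (q + h) + h = - q by ring.
by rewrite (mulrC (tl T i (- p))) (mulrC (tl T i (- (p + h)))); apply; lra.
Qed.

Lemma mul_Mval_le j y (a c : R) : 0 <= a -> 0 <= c ->
  (forall t, 0 <= t <= 1 -> a * Hval T j y t <= c) -> a * Mval T j y <= c.
Proof.
rewrite le_eqVlt => /predU1P[<-|a0] c0 h; first by rewrite mul0r.
rewrite -ler_pdivlMl//; apply: Mval_le => t tI.
by rewrite ler_pdivlMl// h.
Qed.

Lemma mul_Mval_le_half j y (a c : R) : 0 <= a -> 0 <= c -> 0 < Mval T j y ->
  (forall t, 0 <= t <= 1 -> Mval T j y / 2 <= Hval T j y t ->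
    a * Hval T j y t <= c) -> a * Mval T j y <= c.
Proof.
rewrite le_eqVlt => /predU1P[<-|a0] c0 M0 h; first by rewrite mul0r.
rewrite -ler_pdivlMl//; apply: Mval_le_half => // t tI tH.
by rewrite ler_pdivlMl// h.
Qed.

Lemma Hval_mul j k y z t s : Hval T j y t * Hval T k z s = tw T t * tw T s *
  \prod_i (fac T j i (t - y ord0 i) * fac T k i (s - z ord0 i)).
Proof. by rewrite /Hval big_split /= mulrACA. Qed.

(* The factors are totally positive of order 2 because they are log-concave; the
   two products use different branches only at node i, which does not move. *)
Lemma Mval_exchange i y z : (forall l, y ord0 l <= z ord0 l) ->
  y ord0 i = z ord0 i -> (forall l, 0 <= y ord0 l) -> (forall l, z ord0 l <= 1) ->
  Mval T i z * Mval T i.+1 y <= Mval T i y * Mval T i.+1 z.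
Proof.
move=> yz yzi y0 z1.
have key t s : 0 <= t <= 1 -> 0 <= s <= 1 ->
    Hval T i z t * Hval T i.+1 y s <= Hval T i y t * Hval T i.+1 z s.
  move=> /andP[t0 t1] /andP[s0 s1].
  have [Ht|Ht] := leP (Hval T i z t) 0.
    apply: (@le_trans _ _ 0); last by rewrite mulr_ge0// Hval_ge0.
    by rewrite mulr_le0_ge0// Hval_ge0.
  have [Hs|Hs] := leP (Hval T i.+1 y s) 0.
    apply: (@le_trans _ _ 0); last by rewrite mulr_ge0// Hval_ge0.
    by rewrite mulr_ge0_le0// Hval_ge0.
  (* Positivity puts [t] to the left and [s] to the right of the common node [i]; hence [t < s], the
     order that [fac_tp] needs. *)
  have tz := fac_gt0_side ((Hval_gt0_fac Ht).2 i).
  have sy := fac_gt0_side ((Hval_gt0_fac Hs).2 i).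
  rewrite ltnn in tz; rewrite ltnSn in sy.
  rewrite !Hval_mul ler_wpM2l ?mulr_ge0 ?tw_ge0//.
  apply: ler_prod => l _; rewrite mulr_ge0 ?fac_ge0//=.
  have [->|li] := eqVneq l i; first by rewrite yzi.
  have facS u : fac T i.+1 l u = fac T i l u.
    by rewrite /fac ltnS leq_eqVlt (inj_eq val_inj) (negbTE li).
  rewrite !facS.
  have := @fac_tp i l (t - z ord0 l) (s - z ord0 l) (z ord0 l - y ord0 l).
  have -> : s - z ord0 l + (z ord0 l - y ord0 l) = s - y ord0 l by ring.
  have -> : t - z ord0 l + (z ord0 l - y ord0 l) = t - y ord0 l by ring.
  have := yz l; have := y0 l; have := z1 l => ? ? ?.
  by apply; lra.
have M0 : 0 <= Mval T i y * Mval T i.+1 z by rewrite mulr_ge0// Mval_ge0.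
apply: mul_Mval_le => //; first exact: Mval_ge0.
move=> s sI; rewrite mulrC; apply: mul_Mval_le => //; first exact: Hval_ge0.
move=> t tI; rewrite mulrC; apply: (le_trans (key t s tI sI)).
by apply: ler_pM; rewrite ?Hval_ge0// Hval_le_Mval.
Qed.

(* (PM_0) compares the increments of the two branches of a kernel, and strict
   concavity makes the comparison strict because [t_end] keeps near-maximisers of
   the first and the last function at a distance less than 1 from each other. *)
Lemma Mval_wrap e : 0 < e -> exists2 eta, 0 < eta &
  forall y z, (forall l, y ord0 l <= z ord0 l) ->
    e <= Mval T 0 y -> e <= Mval T n z ->
    Mval T n z * Mval T 0 y <=
      expR (- (eta * \sum_l (z ord0 l - y ord0 l))) * (Mval T n y * Mval T 0 z).
Proof.
move=> e0; have e20 : 0 < e / 2 by lra.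
have [d1 d10 h1] := Hval_away T e20.
(* Whichever end is excluded, two points of [0, 1] where the weight is not small differ by less than
   1. *)
have [d2 d20 h2] : exists2 d2, 0 < d2 & forall t s, 0 <= t <= 1 ->
    0 <= s <= 1 -> d1 <= tw T t -> d1 <= tw T s -> s - t <= 1 - d2.
  case: (t_end T) => /(_ _ d10)[d2 d20 hd2]; exists d2 => // t s tI sI wt ws.
    by have := hd2 _ tI wt; move: sI tI => /andP[_ s1] /andP[t0 _]; lra.
  by have := hd2 _ sI ws; move: sI tI => /andP[_ s1] /andP[t0 _]; lra.
set d := Num.min d1 d2.
have d0 : 0 < d by rewrite lt_min d10.
have [dd1 dd2] : d <= d1 /\ d <= d2 by rewrite /d !ge_min !lexx orbT.
have /choice[f fP] : forall i, exists eta, _ :=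
  fun i => (exists2P _ _).1 (t_exchange T i d0).
exists (\big[Num.min/1]_i f i) => [|y z yz ey ez].
  by apply: lt_bigmin => // i _; exact: (fP i).1.
set eta := \big[Num.min/1]_i f i; set E := expR _.
have E0 : 0 <= E by exact: expR_ge0.
have C0 : 0 <= E * (Mval T n y * Mval T 0 z).
  by rewrite !mulr_ge0// Mval_ge0.
apply: mul_Mval_le_half => //; [exact: Mval_ge0|exact: lt_le_trans ey|].
move=> t tI tH; rewrite mulrC; apply: mul_Mval_le_half => //.
- exact: Hval_ge0.
- exact: lt_le_trans ez.
move=> s sI sH; rewrite mulrC.
have {tH} [wt ht] : d1 <= tw T t /\ forall i, t - y ord0 i <= - d1.
  have [|? h] := h1 0%N y t; first by apply: le_trans tH; rewrite ler_pM2r.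
  by split=> // i; have := h i; rewrite ltn0.
have {sH} [ws hs] : d1 <= tw T s /\ forall i, d1 <= s - z ord0 i.
  have [|? h] := h1 n z s; first by apply: le_trans sH; rewrite ler_pM2r.
  by split=> // i; have := h i; rewrite ltn_ord.
have st := h2 _ _ tI sI wt ws.
apply: (@le_trans _ _ (E * (Hval T n y s * Hval T 0 z t))); last first.
  by rewrite ler_wpM2l//; apply: ler_pM; rewrite ?Hval_ge0// Hval_le_Mval.
rewrite !Hval_mul mulrCA ler_wpM2l ?mulr_ge0 ?tw_ge0//.
have -> : E = \prod_l expR (- (eta * (z ord0 l - y ord0 l))).
  by rewrite /E mulr_sumr -sumrN expR_sum.
rewrite -big_split; apply: ler_prod => l _; rewrite mulr_ge0 ?fac_ge0//=.
rewrite /fac ltn_ord /=.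
have hyz : 0 <= z ord0 l - y ord0 l by rewrite subr_ge0.
(* With these arguments the last hypothesis of [t_exchange] reads [d <= 1 - (s - t)], which is what
   the end condition has provided. *)
have := (fP l).2 (s - z ord0 l) (t - y ord0 l) (z ord0 l - y ord0 l).
have -> : s - z ord0 l + (z ord0 l - y ord0 l) = s - y ord0 l by ring.
have -> : t - y ord0 l - (z ord0 l - y ord0 l) = t - z ord0 l by ring.
have hl := ht l; have sl := hs l.
move=> h; have {}h := h ltac:(lra) hyz ltac:(lra) ltac:(lra) ltac:(lra) ltac:(lra).
apply: (le_trans h); apply: ler_wpM2r.
  by rewrite mulr_ge0//; apply: hk_ge0; [exact: tr_half|exact: tl_half].
by rewrite ler_expR lerN2 ler_wpM2r// /eta bigmin_le.
Qed.

End Exchange.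

(** * Injectivity and the local Lipschitz bounds *)

Section LocalBiLipschitz.
Variables (R : realType) (n : nat) (T : translates R n).
Implicit Types (y z a b : 'rV[R]_n) (j : nat) (i : 'I_n).

Local Notation M := (Mval T).

(** Exponential form of [Y]: positivity of all M_j already forces the nodes to be strictly
    increasing in (0, 1). *)
Definition Mpos y := forall j, (j <= n)%N -> 0 < M j y.

Definition Psi y : 'rV[R]_n := \row_i (ln (M i.+1 y) - ln (M i y)).

Definition row_max a b : 'rV[R]_n := \row_i Num.max (a ord0 i) (b ord0 i).

Definition ordered_row y := (forall i, 0 <= y ord0 i <= 1) /\
  (forall i k : 'I_n, (i <= k)%N -> y ord0 i <= y ord0 k).

Lemma Mpos_range y i : Mpos y -> 0 < y ord0 i < 1.
Proof.
move=> My; have [t /andP[t0 t1] Ht] := Mval_gt0_ex (My i (ltnW (ltn_ord i))).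
have [s /andP[s0 s1] Hs] := Mval_gt0_ex (My i.+1 (ltn_ord i)).
have := fac_gt0_side ((Hval_gt0_fac Ht).2 i); rewrite ltnn.
have := fac_gt0_side ((Hval_gt0_fac Hs).2 i); rewrite ltnSn.
by move=> *; apply/andP; lra.
Qed.

Lemma Mval_succ_gt0_lt y i (k : 'I_n) : 0 < M i.+1 y -> (i < k)%N -> y ord0 i < y ord0 k.
Proof.
move=> /Mval_gt0_ex[t _ Ht] ik.
have := fac_gt0_side ((Hval_gt0_fac Ht).2 i); rewrite ltnSn.
have := fac_gt0_side ((Hval_gt0_fac Ht).2 k); rewrite ltnS leqNgt ik /=.
by lra.
Qed.

Lemma Mpos_ordered y : Mpos y -> ordered_row y.
Proof.
move=> My; split=> [i|i k].
  by have := Mpos_range i My => /andP[? ?]; apply/andP; lra.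
rewrite leq_eqVlt => /predU1P[/val_inj -> //|ik].
by apply/ltW/Mval_succ_gt0_lt => //; exact/My/ltn_ord.
Qed.

Lemma ordered_row_max a b : ordered_row a -> ordered_row b ->
  ordered_row (row_max a b).
Proof.
move=> [a1 a2] [b1 b2]; split=> [i|i k ik]; rewrite !mxE.
  by case: (leP (a ord0 i)).
by rewrite ge_max !le_max a2// b2// orbT.
Qed.

(* For ordered nodes the intervals cover [0, 1], so some maximum is positive. *)
Lemma ordered_Mval_gt0 y : ordered_row y -> exists2 j, (j <= n)%N & 0 < M j y.
Proof.
move=> [y01 ymono]; have [t [tI wt ty]] := t_support T y01.
(* The least [j] with [P j] is the index of the interval containing [t]; by minimality and
   monotonicity every earlier node is at most [t]. *)
pose P (j : nat) := [forall i : 'I_n, (j <= i)%N ==> (t < y ord0 i)].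
have Pn : exists j, P j.
  by exists n; apply/forallP => i; rewrite leqNgt ltn_ord.
have jn : (ex_minn Pn <= n)%N.
  by case: ex_minnP => j _; apply; apply/forallP => i; rewrite leqNgt ltn_ord.
exists (ex_minn Pn) => //.
case: ex_minnP jn => j /forallP Pj jmin jn.
apply: lt_le_trans (Hval_le_Mval T j y tI); apply: Hval_gt0 => // i.
have [tyi tyi1] := ty i.
rewrite /fac; case: ltnP => ij.
  apply: (hk_gt0 (tr_half T i)).
  have yt : y ord0 i < t.
    rewrite lt_neqAle eq_sym tyi /= leNgt; apply/negP => t_lt.
    have : (j <= i)%N; last by rewrite leqNgt ij.
    apply: jmin; apply/forallP => k; apply/implyP => ik.
    by apply: (lt_le_trans t_lt); exact: ymono.
  by move: tyi1; rewrite gtr0_norm ?subr_gt0// => h; apply/andP; lra.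
have yt := implyP (Pj i) ij.
apply: (hk_gt0 (tl_half T i)).
by move: tyi1; rewrite ltr0_norm ?subr_lt0// => h; apply/andP; lra.
Qed.

Lemma sum_Psi y : \sum_i Psi y ord0 i = ln (M n y) - ln (M 0 y).
Proof.
transitivity (\sum_(0 <= j < n) (ln (M j.+1 y) - ln (M j y))).
  by rewrite big_mkord; apply: eq_bigr => i _; rewrite mxE.
by rewrite telescope_sumr.
Qed.

Lemma Psi_exchange a z i : Mpos a -> Mpos z ->
  (forall l, a ord0 l <= z ord0 l) -> a ord0 i = z ord0 i ->
  Psi a ord0 i <= Psi z ord0 i.
Proof.
move=> Ma Mz az azi; have pos j w : Mpos w -> (j <= n)%N -> M j w \is Num.pos.
  by move=> Mw jn; exact: Mw.
have := Mval_exchange T az azi (fun l => ltW (andP (Mpos_range l Ma)).1)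
  (fun l => ltW (andP (Mpos_range l Mz)).2).
have i1 := ltn_ord i; have i0 := ltnW i1.
rewrite -ler_ln ?posrE ?mulr_gt0 ?Ma ?Mz//.
by rewrite !lnM ?posrE ?Ma ?Mz// !mxE; lra.
Qed.

Lemma Psi_wrap e : 0 < e -> exists2 eta, 0 < eta &
  forall a z, Mpos a -> Mpos z -> (forall l, a ord0 l <= z ord0 l) ->
    e <= M 0 a -> e <= M n z ->
    \sum_i Psi z ord0 i + eta * \sum_l (z ord0 l - a ord0 l) <=
    \sum_i Psi a ord0 i.
Proof.
move=> e0; have [eta eta0 h] := Mval_wrap T e0; exists eta => //.
move=> a z Ma Mz az ea ez; have := h a z az ea ez.
rewrite -ler_ln ?posrE ?mulr_gt0 ?Ma ?Mz ?expR_gt0//.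
rewrite !lnM ?posrE ?mulr_gt0 ?Ma ?Mz ?expR_gt0// expRK !sum_Psi; lra.
Qed.

(* Compare a and b through z = max(a, b): each component of Psi z is at least
   that of a or of b, while the sum of the components strictly decreases. *)
Lemma Psi_lower m : 0 < m -> exists2 L, 0 < L & forall a b, Mpos a -> Mpos b ->
  Mpos (row_max a b) -> m <= M 0 a -> m <= M 0 b -> m <= M n (row_max a b) ->
  `|a - b| <= L * `|Psi a - Psi b|.
Proof.
move=> m0; have [eta eta0 h] := Psi_wrap m0.
(* Each of the [n] components of [Psi] loses at most [e] in the passage to [z], so [eta] times the
   displacement is at most [n%:R * e]; the successor keeps the constant positive for [n = 0]. *)
have L0 : 0 < n.+1%:R / eta by rewrite divr_gt0.
exists (n.+1%:R / eta) => // a b Ma Mb; set z := row_max a b => Mz ma mb mz.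
set e := `|Psi a - Psi b|.
have az l : a ord0 l <= z ord0 l by rewrite mxE le_max lexx.
have bz l : b ord0 l <= z ord0 l by rewrite mxE le_max lexx orbT.
have ab_e i : `|Psi a ord0 i - Psi b ord0 i| <= e.
  by have := row_norm_coord (Psi a - Psi b) i; rewrite !mxE.
have zab i : Psi a ord0 i - e <= Psi z ord0 i /\ Psi b ord0 i - e <= Psi z ord0 i.
  have /ler_normlP[h1 h2] := ab_e i.
  have [E|E] : a ord0 i = z ord0 i \/ b ord0 i = z ord0 i.
  - by rewrite mxE; case: (leP (a ord0 i)) => _; [right|left].
  - by have := Psi_exchange Ma Mz az E; lra.
  - by have := Psi_exchange Mb Mz bz E; lra.
have side c : Mpos c -> m <= M 0 c -> (forall l, c ord0 l <= z ord0 l) ->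
    (forall i, Psi c ord0 i - e <= Psi z ord0 i) ->
    forall i, z ord0 i - c ord0 i <= n.+1%:R / eta * e.
  move=> Mc mc cz hc i.
  have h1 := h c z Mc Mz cz mc mz.
  have h2 : \sum_i (Psi c ord0 i - e) <= \sum_i Psi z ord0 i.
    by apply: ler_sum => l _.
  rewrite big_split/= sumr_const card_ord mulNrn -mulr_natl in h2.
  have h3 : z ord0 i - c ord0 i <= \sum_l (z ord0 l - c ord0 l).
    rewrite (bigD1 i)//= lerDl sumr_ge0// => l _; by rewrite subr_ge0.
  rewrite mulrAC ler_pdivlMr// mulrC.
  have h4 : eta * (z ord0 i - c ord0 i) <= eta * \sum_l (z ord0 l - c ord0 l).
    by rewrite ler_pM2l.
  have e0 : 0 <= e by exact: normr_ge0.
  by rewrite -natr1 mulrDl mul1r; lra.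
have ha := side a Ma ma az (fun i => (zab i).1).
have hb := side b Mb mb bz (fun i => (zab i).2).
apply: row_norm_le => [|i]; first by rewrite mulr_ge0 ?normr_ge0// ltW.
rewrite !mxE ler_norml; have := ha i; have := hb i; have := az i; have := bz i.
by move=> *; apply/andP; split; lra.
Qed.

(** One M_j is positive because the maximum is again ordered. Positivity moves from M_j to M_(j+1)
    by the exchange inequality and from M_n back to M_0 by [Mval_wrap], so it reaches every
    index. *)
Lemma Mpos_row_max a b : Mpos a -> Mpos b -> Mpos (row_max a b).
Proof.
move=> Ma Mb; set z := row_max a b.
have oz : ordered_row z by apply: ordered_row_max; exact: Mpos_ordered.
have az l : a ord0 l <= z ord0 l by rewrite mxE le_max lexx.
have bz l : b ord0 l <= z ord0 l by rewrite mxE le_max lexx orbT.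
have up j : (j < n)%N -> 0 < M j z -> 0 < M j.+1 z.
  move=> jn; pose i := Ordinal jn; rewrite -[j]/(val i) => Mi.
  have step c : Mpos c -> (forall l, c ord0 l <= z ord0 l) ->
      c ord0 i = z ord0 i -> 0 < M i.+1 z.
    move=> Mc cz ci.
    have := Mval_exchange T cz ci (fun l => ltW (andP (Mpos_range l Mc)).1)
      (fun l => (andP (oz.1 l)).2).
    have h : 0 < M i z * M i.+1 c by rewrite mulr_gt0//; exact: Mc.
    have Mic : 0 < M i c by apply: Mc; exact: ltnW.
    by move=> /(lt_le_trans h); rewrite (pmulr_rgt0 _ Mic).
  have [E|E] : a ord0 i = z ord0 i \/ b ord0 i = z ord0 i.
  - by rewrite mxE; case: (leP (a ord0 i)) => _; [right|left].
  - exact: step Ma az E.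
  - exact: step Mb bz E.
have upto j k : (j <= k)%N -> (k <= n)%N -> 0 < M j z -> 0 < M k z.
  elim: k => [|k IH]; first by rewrite leqn0 => /eqP ->.
  rewrite leq_eqVlt => /predU1P[->//|jk] kn Mj.
  by apply: up => //; apply: IH => //; exact: ltnW.
have [j jn Mj] := ordered_Mval_gt0 oz.
have Mn : 0 < M n z by exact: upto Mj.
have M0 : 0 < M 0 z.
  have e0 : 0 < Num.min (M 0 a) (M n z) by rewrite lt_min Ma// Mn.
  have [eta _ h] := Mval_wrap T e0.
  have := h a z az; rewrite !ge_min !lexx orbT => /(_ isT isT).
  have p : 0 < M n z * M 0 a by rewrite mulr_gt0// Ma.
  by move=> /(lt_le_trans p); rewrite pmulr_rgt0 ?expR_gt0// pmulr_rgt0// Ma.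
by move=> k kn; exact: upto M0.
Qed.

Lemma Psi_inj a b : Mpos a -> Mpos b -> Psi a = Psi b -> a = b.
Proof.
move=> Ma Mb Pab; have Mz := Mpos_row_max Ma Mb.
set m := Num.min (Num.min (M 0 a) (M 0 b)) (M n (row_max a b)).
have m0 : 0 < m by rewrite !lt_min Ma// Mb// Mz.
have [L L0 h] := Psi_lower m0.
have := h a b Ma Mb Mz; rewrite /m !ge_min !lexx !orbT => /(_ isT isT isT).
rewrite Pab subrr normr0 mulr0 normr_le0 subr_eq0.
by move/eqP.
Qed.

Lemma fac_lip d : 0 < d -> exists2 L, 0 < L & forall j i u v,
  (if (i < j)%N then d <= u <= 1 - d else d <= - u <= 1 - d) ->
  (if (i < j)%N then d <= v <= 1 - d else d <= - v <= 1 - d) ->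
  fac T j i u <= fac T j i v * expR (L * `|u - v|).
Proof.
move=> d0.
have lip (k : 'I_n -> R -> R) : (forall i, half_kernel (k i)) ->
    exists2 L, 0 < L & forall i s t, d <= s <= 1 - d -> d <= t <= 1 - d ->
      k i s <= k i t * expR (L * `|s - t|).
  move=> hk; have /choice[f fP] : forall i, exists L, _ :=
    fun i => (exists2P _ _).1 (hk_lip (hk i) d0).
  exists (1 + \sum_i f i) => [|i s t sI tI].
    by rewrite ltr_pwDl// sumr_ge0// => i _; rewrite ltW// (fP i).1.
  apply: (le_trans ((fP i).2 s t sI tI)).
  rewrite ler_wpM2l ?hk_ge0// ler_expR ler_wpM2r//.
  rewrite ler_wpDl// (bigD1 i)//= lerDl sumr_ge0// => l _.
  by rewrite ltW// (fP l).1.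
have [L1 L10 h1] := lip _ (tr_half T); have [L2 L20 h2] := lip _ (tl_half T).
exists (L1 + L2) => [|j i u v]; first exact: addr_gt0.
rewrite /fac; case: ifP => _ uI vI.
  apply: (le_trans (h1 i u v uI vI)); apply: ler_wpM2l.
    by apply: hk_ge0; exact: tr_half.
  by rewrite ler_expR ler_wpM2r// lerDl ltW.
apply: (le_trans (h2 i _ _ uI vI)); apply: ler_wpM2l.
  by apply: hk_ge0; exact: tl_half.
by rewrite ler_expR -opprD normrN ler_wpM2r// lerDr ltW.
Qed.

Lemma Mpos_nbhs y : Mpos y -> exists2 m, 0 < m & exists2 d, 0 < d &
  forall a, (forall i, `|y ord0 i - a ord0 i| < d) ->
    (forall j, (j <= n)%N -> m <= M j a) /\ (forall i, m <= a ord0 i <= 1 - m).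
Proof.
move=> My.
pose m1 := \big[Num.min/1]_(j < n.+1) M j y.
pose m2 := \big[Num.min/1]_i Num.min (y ord0 i) (1 - y ord0 i).
have m10 : 0 < m1 by apply: lt_bigmin => // j _; apply: My; rewrite -ltnS.
have m20 : 0 < m2.
  apply: lt_bigmin => // i _; have /andP[? ?] := Mpos_range i My.
  by rewrite lt_min subr_gt0; apply/andP.
pose m := Num.min m1 m2 / 2.
have mm : 0 < m by rewrite divr_gt0// lt_min m10.
have mm1 : m <= m1 / 2 by rewrite ler_pM2r// ge_min lexx.
have mm2 : m <= m2 / 2 by rewrite ler_pM2r// ge_min lexx orbT.
have [d d0 hd] := Mval_ucont T mm.
exists m => //; exists (Num.min d m) => [|a ya]; first by rewrite lt_min d0.
split=> [j jn|i].
  have := hd j y a _; rewrite ler_norml.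
  have /= j1 := @bigmin_le _ _ _ (1 : R) (Ordinal (jn : (j < n.+1)%N)) (fun j : 'I_n.+1 => M j y).
  rewrite -/m1 in j1.
  case/(_ _)/andP => [i|_]; last lra.
  by have := ya i; rewrite lt_min => /andP[].
have /= i1 := @bigmin_le _ _ _ (1 : R) i (fun i => Num.min (y ord0 i) (1 - y ord0 i)).
rewrite -/m2 le_min in i1; move: i1 => /andP[i1 i2].
have := ya i; rewrite lt_min => /andP[_ /ltr_normlP[? ?]].
by apply/andP; lra.
Qed.

(** At half-maximisers for [a] the arguments of all factors, for [a] and for [b], stay away from 0
    and from -1 and 1, where the logarithms of the branches could fail to be Lipschitz. *)
Lemma lnMval_lip y : Mpos y -> exists2 e, 0 < e & exists2 L, 0 < L &
  forall a b, ball y e a -> ball y e b -> forall j, (j <= n)%N ->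
    ln (M j a) - ln (M j b) <= L * `|a - b|.
Proof.
move=> My; have [m m0 [d d0 near_y]] := Mpos_nbhs My.
have m20 : 0 < m / 2 by lra.
have [r r0 away] := Hval_away T m20.
(* Nodes of [a] and [b] will differ by less than [q <= r / 2], so distance [r] from the former
   leaves [q] from the latter; [q <= m / 2] takes care of -1 and 1. *)
pose q := Num.min r m / 2.
have q0 : 0 < q by rewrite divr_gt0// lt_min r0.
have qr : q <= r / 2 by rewrite ler_pM2r// ge_min lexx.
have qm : q <= m / 2 by rewrite ler_pM2r// ge_min lexx orbT.
have [L L0 lip] := fac_lip q0.
pose e := Num.min d (q / 2).
have e0 : 0 < e by rewrite lt_min d0 divr_gt0.
have [ed eq2] : e <= d /\ e <= q / 2 by rewrite /e !ge_min !lexx orbT.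
exists e => //; exists (n.+1%:R * L); first by rewrite mulr_gt0.
move=> a b /(row_ballP _ _ e0) ya /(row_ballP _ _ e0) yb j jn.
have [Ma aI] := near_y a (fun i => lt_le_trans (ya i) ed).
have [Mb bI] := near_y b (fun i => lt_le_trans (yb i) ed).
have Ma0 : 0 < M j a by exact: lt_le_trans (Ma j jn).
have Mb0 : 0 < M j b by exact: lt_le_trans (Mb j jn).
rewrite lerBlDr -ler_expR expRD !lnK ?posrE//.
apply: Mval_le_half => // t /andP[t0 t1] Ht.
have [_ tside] := away j a t ltac:(by have := Ma j jn; lra).
apply: (@le_trans _ _ (expR (n.+1%:R * L * `|a - b|) * Hval T j b t)); last first.
  by rewrite ler_wpM2l ?expR_ge0// Hval_le_Mval// t0.
rewrite /Hval mulrCA ler_wpM2l ?tw_ge0//.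
apply: (@le_trans _ _ (\prod_i (fac T j i (t - b ord0 i) * expR (L * `|a - b|)))).
  apply: ler_prod => i _; rewrite fac_ge0 /=.
  have : fac T j i (t - a ord0 i) <= fac T j i (t - b ord0 i) *
      expR (L * `|t - a ord0 i - (t - b ord0 i)|).
    have := tside i; have /andP[a1 a2] := aI i; have /andP[b1 b2] := bI i.
    have /ltr_normlP[ya1 ya2] := ya i; have /ltr_normlP[yb1 yb2] := yb i.
    by move=> ti; apply: lip; move: ti; case: ifP => _ ti; apply/andP; lra.
  move=> /le_trans; apply; rewrite ler_wpM2l ?fac_ge0// ler_expR ler_pM2l//.
  have -> : t - a ord0 i - (t - b ord0 i) = - ((a - b) ord0 i).
    by rewrite !mxE; ring.
  by rewrite normrN row_norm_coord.
rewrite big_split/= mulrC ler_wpM2r//.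
  by apply: prodr_ge0 => i _; exact: fac_ge0.
rewrite prodr_const card_ord -expRM_natl ler_expR -mulrA ler_wpM2r//.
  by rewrite mulr_ge0// ltW.
by rewrite ler_nat.
Qed.

Lemma Psi_bilip y : Mpos y -> exists2 e, 0 < e & exists2 L, 0 < L &
  forall a b, Mpos a -> Mpos b -> ball y e a -> ball y e b ->
    `|a - b| <= L * `|Psi a - Psi b| /\ `|Psi a - Psi b| <= L * `|a - b|.
Proof.
move=> My; have [m m0 [d d0 near_y]] := Mpos_nbhs My.
have [L1 L10 low] := Psi_lower m0.
have [e1 e10 [L2 L20 up]] := lnMval_lip My.
have e0 : 0 < Num.min d e1 by rewrite lt_min d0.
exists (Num.min d e1) => //; exists (L1 + 2 * L2).
  by rewrite addr_gt0// mulr_gt0.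
move=> a b Ma Mb ya yb.
have ya1 : ball y e1 a by apply: le_ball ya; rewrite ge_min lexx orbT.
have yb1 : ball y e1 b by apply: le_ball yb; rewrite ge_min lexx orbT.
have close c : ball y (Num.min d e1) c -> forall i, `|y ord0 i - c ord0 i| < d.
  by move=> /(row_ballP _ _ e0) yc i; have := yc i; rewrite lt_min => /andP[].
have ya2 := close _ ya; have yb2 := close _ yb.
split.
  apply: (@le_trans _ _ (L1 * `|Psi a - Psi b|)); last first.
    by rewrite ler_wpM2r// lerDl mulr_ge0// ltW.
  apply: low => //; first exact: Mpos_row_max.
  - exact: (near_y a ya2).1.
  - exact: (near_y b yb2).1.
  - apply: (near_y _ _).1 => // i; rewrite mxE.
    by case: (leP (a ord0 i)).
apply: (@le_trans _ _ (2 * L2 * `|a - b|)); last first.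
  by rewrite ler_wpM2r// lerDr ltW.
apply: row_norm_le => [|i]; first by rewrite !mulr_ge0// ltW.
have i1 := ltn_ord i; have i0 := ltnW i1.
have := up a b ya1 yb1 _ i1; have := up a b ya1 yb1 _ i0.
have := up b a yb1 ya1 _ i1; have := up b a yb1 ya1 _ i0.
rewrite (distrC b) !mxE => *; rewrite ler_norml; apply/andP; lra.
Qed.

End LocalBiLipschitz.

(** * Surjectivity and continuity of the inverse *)

Section Surjectivity.
Variables (R : realType) (n : nat) (T : translates R n).
Implicit Types (y z : 'rV[R]_n) (j : nat) (i k : 'I_n) (c : 'rV[R]_n).

Local Notation M := (Mval T).

Lemma closed_le_continuous (f g : 'rV[R]_n -> R) :
  continuous f -> continuous g -> closed [set y | f y <= g y].
Proof.
move=> cf cg.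
rewrite (_ : mkset _ = (fun y => g y - f y) @^-1` [set x | 0 <= x]); last first.
  by apply/seteqP; split=> y /=; rewrite subr_ge0.
apply: preimage_closed; last exact: closed_ge.
by move=> y _; apply: continuousB; [exact: cg|exact: cf].
Qed.

Lemma closed_forall (I : Type) (P : I -> 'rV[R]_n -> Prop) :
  (forall x, closed (P x)) -> closed [set y | forall x, P x y].
Proof.
move=> cP; rewrite (_ : mkset _ = \bigcap_(x in setT) P x).
  by apply: closed_bigI => x _; exact: cP.
by apply/seteqP; split=> y /= h x //; exact: h.
Qed.

Lemma coord_cont i : continuous (fun y : 'rV[R]_n => y ord0 i).
Proof. exact: coord_continuous. Qed.

Lemma sum_cont (F : 'I_n -> 'rV[R]_n -> R) : (forall i, continuous (F i)) ->
  continuous (fun y => \sum_i F i y).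
Proof.
by move=> cF; exact: (continuous_big (@add_continuous _) (fun i _ => cF i)).
Qed.

Lemma closed_ordered_row : closed (@ordered_row R n).
Proof.
have -> : @ordered_row R n = [set y | forall i, 0 <= y ord0 i] `&`
    ([set y | forall i, y ord0 i <= 1] `&` [set y | forall i k : 'I_n,
      (i <= k)%N -> y ord0 i <= y ord0 k]).
  apply/seteqP; split=> y /=.
    move=> [y01 ym]; split; last split => //.
      by move=> i; case/andP: (y01 i).
    by move=> i; case/andP: (y01 i).
  move=> [y0 [y1 ym]]; split=> // i; by rewrite y0 y1.
apply: closedI; [|apply: closedI]; apply: closed_forall => i.
- by apply: closed_le_continuous; [exact: cst_continuous|exact: coord_cont].
- by apply: closed_le_continuous; [exact: coord_cont|exact: cst_continuous].
- apply: closed_forall => k; apply: closed_forall => _.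
  by apply: closed_le_continuous; exact: coord_cont.
Qed.

Lemma compact_ordered (A : set 'rV[R]_n) : closed A ->
  A `<=` @ordered_row R n -> compact A.
Proof.
move=> cA Ao; apply: (subclosed_compact cA
  (@rV_compact R n (fun=> `[0, 1]%classic) (fun=> @segment_compact R 0 1))).
by move=> y /Ao[y01 _] i /=; rewrite in_itv/= y01.
Qed.

(** The equations pass positivity between neighbours, so either all M_j are positive or none is;
    ordered nodes exclude the latter. *)
Lemma Psi_eqP y c : ordered_row y ->
  (forall i, M i y * expR (c ord0 i) = M i.+1 y) -> Mpos T y /\ Psi T y = c.
Proof.
move=> oy yc.
have step j : (j < n)%N -> (0 < M j y) = (0 < M j.+1 y).
  move=> jn; have <- := yc (Ordinal jn).
  by rewrite pmulr_lgt0 ?expR_gt0.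
have all0 j : (j <= n)%N -> (0 < M j y) = (0 < M 0 y).
  by elim: j => // j IH jn; rewrite -step// IH// ltnW.
have [j jn Mj] := ordered_Mval_gt0 T oy.
have My : Mpos T y by move=> k kn; rewrite all0// -(all0 j).
split=> //; apply/rowP => i; rewrite mxE -yc.
rewrite lnM ?posrE ?expR_gt0 ?My ?(ltnW (ltn_ord i))//.
by rewrite expRK addrC addKr.
Qed.

Section Maximiser.
Variable c : 'rV[R]_n.

(** Stated without logarithms, the constraint makes sense where some M_j vanish and defines a closed
    set; this is what makes it compact. *)
Definition subsolution : set 'rV[R]_n :=
  [set y | ordered_row y /\ forall i, M i y * expR (c ord0 i) <= M i.+1 y].

Lemma compact_subsolution : compact subsolution.
Proof.
apply: compact_ordered; last by move=> y [].
apply: closedI; first exact: closed_ordered_row.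
apply: closed_forall => i; apply: closed_le_continuous.
  move=> y; apply: continuousM; last exact: cst_continuous.
  exact: Mval_continuous.
exact: Mval_continuous.
Qed.

(** With all nodes at 0, no point of [0, 1] lies to the left of node [i], so the left side of each
    constraint vanishes. *)
Lemma subsolution0 : subsolution 0.
Proof.
split; first by split=> [i|i k _]; rewrite !mxE// lexx ler01.
move=> i; suff : M i 0 <= 0.
  move=> M0; apply: (@le_trans _ _ 0); last exact: Mval_ge0.
  by rewrite mulr_le0_ge0// expR_ge0.
apply: Mval_le => t /andP[t0 t1]; rewrite leNgt; apply/negP => Ht.
have := fac_gt0_side ((Hval_gt0_fac Ht).2 i); rewrite ltnn mxE; lra.
Qed.

(* Pushing node i to the right preserves the other inequalities, by the exchange
   lemma, and also this one if it was strict. *)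
Lemma subsolution_raise y i : subsolution y ->
  M i y * expR (c ord0 i) < M i.+1 y ->
  exists2 z, subsolution z & \sum_k y ord0 k < \sum_k z ord0 k.
Proof.
move=> [[y01 ymono] yc] slack.
set E := expR (c ord0 i) in slack.
have E0 : 0 < E by exact: expR_gt0.
have Mi1 : 0 < M i.+1 y.
  by apply: le_lt_trans slack; rewrite mulr_ge0 ?Mval_ge0// ltW.
(* Such a [t] lies strictly between node [i] and all later nodes, so raising node [i] no further
   than [t] preserves the order. *)
have [t /andP[t0 t1] Ht] := Mval_gt0_ex Mi1.
have yt : y ord0 i < t.
  by have := fac_gt0_side ((Hval_gt0_fac Ht).2 i); rewrite ltnSn subr_gt0.
have ty k : (i < k)%N -> t < y ord0 k.
  move=> ik; have := fac_gt0_side ((Hval_gt0_fac Ht).2 k).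
  by rewrite ltnS leqNgt ik /= subr_lt0.
(* Errors of [eps] in both maxima cost at most [eps * (1 + E)], half of the slack. *)
pose eps := (M i.+1 y - M i y * E) / (2 * (1 + E)).
have eps0 : 0 < eps by rewrite divr_gt0 ?subr_gt0// mulr_gt0// addr_gt0.
have [d d0 hd] := Mval_ucont T eps0.
pose r := Num.min (d / 2) (t - y ord0 i).
have r0 : 0 < r by rewrite lt_min subr_gt0 yt divr_gt0.
have rd : r <= d / 2 by rewrite ge_min lexx.
have rt : r <= t - y ord0 i by rewrite ge_min lexx orbT.
pose z : 'rV[R]_n := \row_k (if k == i then y ord0 i + r else y ord0 k).
have zi : z ord0 i = y ord0 i + r by rewrite mxE eqxx.
have zk k : k != i -> z ord0 k = y ord0 k by rewrite mxE => /negbTE ->.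
have yz k : y ord0 k <= z ord0 k.
  by have [->|ki] := eqVneq k i; [rewrite zi; lra|rewrite zk].
have z1 k : z ord0 k <= 1.
  have [->|ki] := eqVneq k i; first by rewrite zi; lra.
  by rewrite zk//; case/andP: (y01 k).
have y0 k : 0 <= y ord0 k by case/andP: (y01 k).
exists z; last first.
  rewrite [ltLHS](bigD1 i)//= [ltRHS](bigD1 i)//= zi.
  have -> : \sum_(k | k != i) z ord0 k = \sum_(k | k != i) y ord0 k.
    by apply: eq_bigr => k; exact: zk.
  lra.
split; first split=> [k|k l kl].
- by rewrite z1 andbT (le_trans (y0 k)).
- have [ki|ki] := eqVneq k i; have [li|li] := eqVneq l i.
  + by rewrite ki li.
  + rewrite ki zi zk//.
    have il : (i < l)%N by rewrite ltn_neqAle (inj_eq val_inj) eq_sym li -ki.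
    by have := ty l il; lra.
  + by rewrite li zi zk//; have := ymono k i; rewrite -li => /(_ kl); lra.
  + by rewrite !zk// ymono.
move=> k; have [->|ki] := eqVneq k i.
  have close l : `|y ord0 l - z ord0 l| < d.
    have [->|li] := eqVneq l i; last by rewrite zk// subrr normr0.
    rewrite zi distrC addrAC subrr add0r gtr0_norm//; lra.
  have /ler_normlP[h1 h2] := hd i y z close.
  have /ler_normlP[h3 h4] := hd i.+1 y z close.
  have e2 : eps * (2 * (1 + E)) = M i.+1 y - M i y * E.
    by rewrite divfK// gt_eqF// mulr_gt0// addr_gt0.
  have : M i z * E <= (M i y + eps) * E by rewrite ler_pM2r//; lra.
  have : 0 < eps * E by rewrite mulr_gt0.
  rewrite -/E mulrDl; lra.
have E'0 := expR_gt0 (c ord0 k).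
have [Mk1|Mk1] := ltP 0 (M k.+1 y).
  have yzk : y ord0 k = z ord0 k by rewrite zk.
  have := Mval_exchange T yz yzk y0 z1; have := yc k => h1 h2.
  rewrite -(ler_pM2r Mk1) mulrAC; apply: (le_trans (ler_wpM2r (ltW E'0) h2)).
  by rewrite mulrAC mulrC ler_wpM2l ?Mval_ge0.
(* When [M k.+1 y] vanishes the exchange inequality says nothing. Positivity spreads upward from
   [i.+1], so [k < i]; then [M k z = 0], since a point with a positive product for [z] would have
   one for [y]. *)
have up j : (i < j)%N -> (j <= n)%N -> 0 < M j y.
  elim: j => // j IH; rewrite ltnS leq_eqVlt => /predU1P[<- //|ij] jn.
  apply: (lt_le_trans _ (yc (Ordinal jn))).
  by rewrite mulr_gt0 ?expR_gt0//; apply: IH => //; exact: ltnW.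
have Mk : M k y <= 0.
  by rewrite -(pmulr_lle0 _ E'0) (le_trans (yc k)).
have ki' : (k < i)%N.
  rewrite ltnNge; apply/negP => ik.
  by have := up k.+1 ik (ltn_ord k); rewrite ltNge Mk1.
suff -> : M k z = 0 by rewrite mul0r Mval_ge0.
apply/eqP; rewrite eq_le Mval_ge0 andbT.
apply: Mval_le => s /andP[s0 s1]; rewrite leNgt; apply/negP => Hs.
have [ws fs] := Hval_gt0_fac Hs.
suff : 0 < Hval T k y s.
  by apply/negP; rewrite -leNgt (le_trans _ Mk)// Hval_le_Mval// s0.
apply: Hval_gt0 => // l; have [->|li] := eqVneq l i; last by rewrite -(zk l li).
have sk := fac_gt0_side (fs k); rewrite ltnn zk// in sk.
have := ymono k i (ltnW ki') => yki.
have si := fac_gt0_side (fs i); rewrite ltnNge (ltnW ki') /= in si.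
rewrite /fac ltnNge (ltnW ki') /=; apply: (hk_gt0 (tl_half T i)).
by have := z1 i; rewrite zi => ?; apply/andP; lra.
Qed.

Lemma Psi_surj : exists2 y, Mpos T y & Psi T y = c.
Proof.
have cont : {within subsolution, continuous (fun y => \sum_k y ord0 k)}.
  by apply: continuous_subspaceT; apply: sum_cont => k; exact: coord_cont.
have [y yU ymax] := EVT_max_rV (ex_intro _ _ subsolution0) compact_subsolution cont.
move: yU; rewrite inE => yU; have [oy yc] := yU.
have [] := @Psi_eqP y c oy; last by move=> My Pc; exists y.
move=> i; apply/eqP; rewrite eq_le yc leNgt; apply/negP => slack.
have [z zU] := subsolution_raise yU slack.
by rewrite ltNge ymax// inE.
Qed.

End Maximiser.

(* By compactness the defect of the equations is bounded below away from their
   only solution. *)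
Lemma Psi_inv_continuous y (e : R) : Mpos T y -> 0 < e -> exists2 d, 0 < d &
  forall y', Mpos T y' -> `|Psi T y - Psi T y'| < d -> `|y - y'| < e.
Proof.
move=> My e0; set c := Psi T y.
have [B B0 hB] := Mval_bound T.
pose A := [set y' | ordered_row y' /\ e <= `|y - y'|].
have cA : compact A.
  apply: compact_ordered; last by move=> y' [].
  apply: closedI; first exact: closed_ordered_row.
  apply: closed_le_continuous; first exact: cst_continuous.
  move=> y'; apply: continuous_comp; last exact: norm_continuous.
  by apply: continuousB; [exact: cst_continuous|exact: cvg_id].
pose D y' := \sum_(i < n) `|M i y' * expR (c ord0 i) - M i.+1 y'|.
have term_cont i : continuous
    (fun y' : 'rV[R]_n => `|M i y' * expR (c ord0 i) - M i.+1 y'|).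
  move=> y'.
  apply: (@continuous_comp _ _ _
    (fun y' : 'rV[R]_n => M i y' * expR (c ord0 i) - M i.+1 y') Num.norm);
    last exact: norm_continuous.
  apply: continuousB; last exact: Mval_continuous.
  by apply: continuousM; [exact: Mval_continuous|exact: cst_continuous].
have D_cont : continuous D by exact: sum_cont.
have [m m0 hm] : exists2 m, 0 < m & forall y', A y' -> m <= D y'.
  have [A0|A0] := pselect (A !=set0); last first.
    by exists 1 => // y' Ay'; exfalso; apply: A0; exists y'.
  have [y0 y0A Dmin] := EVT_min_rV A0 cA (continuous_subspaceT D_cont).
  exists (D y0) => [|y' Ay']; last by apply: Dmin; rewrite inE.
  rewrite lt_neqAle sumr_ge0 ?andbT//; apply/negP => /eqP D0.
  move: y0A; rewrite inE => -[oy0 ey0].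
  have yc i : M i y0 * expR (c ord0 i) = M i.+1 y0.
    apply/eqP; rewrite -subr_eq0 -normr_eq0 eq_le normr_ge0 andbT.
    by rewrite D0 /D (bigD1 i)//= lerDl sumr_ge0.
  have [My0 Pc] := Psi_eqP oy0 yc.
  move: ey0; rewrite (Psi_inj My My0 (esym Pc)) subrr normr0; lra.
(* Each of the [n] terms of the defect will be at most [B * r]; dividing by [n + 1] puts their sum
   strictly below [m]. *)
pose r := m / (B * n.+1%:R).
have r0 : 0 < r by rewrite divr_gt0// mulr_gt0.
have /choice[f fP] i : exists d, 0 < d /\ forall s, `|c ord0 i - s| < d ->
    `|expR (c ord0 i) - expR s| < r.
  have /cvgrPdist_lt/(_ _ r0)[d /= d0 hd] := @continuous_expR R (c ord0 i).
  by exists d; split=> // s; exact: hd.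
exists (\big[Num.min/1]_i f i) => [|y' My' yy'].
  by apply: lt_bigmin => // i _; exact: (fP i).1.
rewrite ltNge; apply/negP => ey'.
have oy' := Mpos_ordered My'.
have := hm y' (conj oy' ey'); apply/negP; rewrite -ltNge.
have bound i : `|M i y' * expR (c ord0 i) - M i.+1 y'| <= B * r.
  have -> : M i.+1 y' = M i y' * expR (Psi T y' ord0 i).
    rewrite mxE expRB !lnK ?posrE ?My' ?(ltnW (ltn_ord i))//.
    by rewrite mulrC divfK// gt_eqF// My'// ltnW.
  rewrite -mulrBr normrM ger0_norm ?Mval_ge0//; apply: ler_pM => //.
    exact: Mval_ge0.
  apply/ltW/(fP i).2; apply: le_lt_trans (lt_le_trans yy' (bigmin_le _ i _)).
  by have := row_norm_coord (c - Psi T y') i; rewrite !mxE.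
apply: (@le_lt_trans _ _ (\sum_(i < n) B * r)); first by apply: ler_sum.
rewrite sumr_const card_ord -mulr_natl /r invfM [B * _]mulrCA.
rewrite mulVKf ?gt_eqF// mulrCA gtr_pMr//.
by rewrite ltr_pdivrMr// mul1r ltr_nat.
Qed.

End Surjectivity.

(** * From extended-valued kernels and fields to their exponentials *)

Section ExpOfExtended.
Variable R : realType.
Implicit Types (K J : R -> \bar R).

Lemma cvg_fine_expeR (F : set_system R) (FF : Filter F) (g : R -> \bar R)
  (l : \bar R) : l != +oo%E -> g @ F --> l ->
  (fun t => fine (expeR (g t))) @ F --> fine (expeR l).
Proof.
case: l => [r|//|] _ gl /=.
  have /fine_cvgP[gfin gfine] := gl.
  have h : \forall t \near F, expR (fine (g t)) = fine (expeR (g t)).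
    by apply: filterS gfin => t; case: (g t).
  apply: cvg_trans (near_eq_cvg h) _.
  apply: (@cvg_comp _ _ _ (fine \o g) expR _ (nbhs r)) => //.
  exact: continuous_expR.
apply/cvgrPdist_le => e e0.
have le_e : \forall t \near F, ((g t) <= (ln e)%:E)%E by exact: cvgeNy_le.
near=> t; have gt_ : ((g t) <= (ln e)%:E)%E by near: t.
rewrite sub0r normrN; case: (g t) gt_ => [s|//|_] /=; last by rewrite normr0 ltW.
by rewrite lee_fin => sle; rewrite ger0_norm ?expR_ge0// -(lnK e0) ler_expR.
Unshelve. all: by end_near. Qed.

Lemma expeR_fin (x : \bar R) : x != +oo%E -> expeR x = (fine (expeR x))%:E.
Proof. by case: x. Qed.

Definition branch K (s : R) : R :=
  if s <= 0 then 0 else fine (expeR (K (Num.min s 1))).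

Lemma branch_in K s : 0 < s < 1 -> K s \is a fin_num ->
  branch K s = expR (fine (K s)).
Proof.
move=> /andP[s0 s1] fs; rewrite /branch leNgt s0 /= min_l ?ltW//.
by move: fs; case: (K s).
Qed.

(** Beyond 1/2 the graph lies below the line through the chord over [1/4, 1/2], hence is bounded
    above near 1. *)
Lemma concave_limit_neqy K : (forall t, 0 < t < 1 -> K t \is a fin_num) ->
  concave_on [set` `]0, 1[] (fun t => fine (K t)) ->
  K t @[t --> 1^'-] --> K 1 -> K 1 != +oo%E.
Proof.
move=> fK cf K1; apply/eqP => K1y; rewrite K1y in K1.
set f := fun t => fine (K t) in cf.
set S := slope f (1 / 4) (1 / 2).
have : \forall t \near (1 : R)^'-, False.
  near=> t.
  have t1 : t < 1 by near: t; exact: nbhs_left_lt.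
  have t2 : 1 / 2 < t by near: t; apply: nbhs_left_gt; lra.
  have : ((f (1 / 2) + `|S| + 1)%:E <= K t)%E by near: t; exact: cvgey_ge.
  have fKt : K t \is a fin_num by apply: fK; apply/andP; lra.
  rewrite -(fineK fKt) lee_fin -/(f t).
  have h : slope f (1 / 2) t <= S by apply: (concave_slope_le cf); lra.
  have := slopeM f t2.
  have : slope f (1 / 2) t * (t - 1 / 2) <= `|S|.
    apply: (@le_trans _ _ (`|S| * (t - 1 / 2))).
      by rewrite ler_wpM2r ?(le_trans h) ?ler_norm//; lra.
    by rewrite ler_piMr//; lra.
  lra.
by move=> /filter_ex[].
Unshelve. all: by end_near. Qed.

Lemma half_kernel_branch K : (forall t, 0 < t < 1 -> K t \is a fin_num) ->
  concave_on [set` `]0, 1[] (fun t => fine (K t)) ->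
  K t @[t --> 0^'+] --> -oo%E -> K t @[t --> 1^'-] --> K 1 ->
  half_kernel (branch K).
Proof.
move=> fK cf K0 K1; have K1y := concave_limit_neqy fK cf K1.
apply: (half_kernel_of_concave cf) => [s s0|s sI|s s1||].
- by rewrite /branch s0.
- by rewrite branch_in// fK.
- by rewrite /branch !leNgt ltr01 (lt_le_trans ltr01 s1)/= minxx min_r.
- have h : \forall s \near 0^'+, fine (expeR (K s)) = branch K s.
    near=> s; have s0 : 0 < s by near: s; exact: nbhs_right_gt.
    have s1 : s < 1 by near: s; exact: nbhs_right_lt.
    by rewrite /branch leNgt s0 /= min_l// ltW.
  apply: cvg_trans (near_eq_cvg h) _.
  exact: (cvg_fine_expeR _ (isT : -oo%E != +oo%E :> \bar R) K0).
- have h : \forall s \near 1^'-, fine (expeR (K s)) = branch K s.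
    near=> s; have s0 : 0 < s by near: s; exact: nbhs_left_gt.
    have s1 : s < 1 by near: s; exact: nbhs_left_lt.
    by rewrite /branch leNgt s0 /= min_l// ltW.
  apply: cvg_trans (near_eq_cvg h) _; rewrite /branch leNgt ltr01 /= minxx.
  exact: (cvg_fine_expeR _ K1y K1).
Unshelve. all: by end_near. Qed.

Section Kernel.
Variable K : R -> \bar R.
Hypotheses (kK : kernel_function K) (sK : singular_kernel K)
  (cK : strictly_concave_kernel K) (pK : PM 0 K).

Lemma kernel_fin t : (- 1 < t < 0) \/ (0 < t < 1) -> K t \is a fin_num.
Proof. by case: kK => h _ _ _ _ tI; apply: h; rewrite !in_itv. Qed.

Lemma half_kernel_right : half_kernel (branch K).
Proof.
have [_ _ cr [K0r _] [_ K1]] := kK.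
apply: half_kernel_branch => //; first by move=> t tI; apply: kernel_fin; right.
by rewrite -sK.
Qed.

Lemma half_kernel_left : half_kernel (branch (K \o -%R)).
Proof.
have [_ cl _ [_ K0l] [K1 _]] := kK.
apply: half_kernel_branch => /=.
- by move=> t tI; apply: kernel_fin; left; apply/andP; lra.
- by have := concave_on_opp cl; rewrite oppr0 opprK.
- by move/cvg_at_leftNP: K0l; rewrite oppr0 sK.
- by move/cvg_at_rightNP: K1; rewrite opprK.
Qed.

(** In logarithms: by (PM_0) the increment from [a] to [a + h] is at least that from [a - 1] to
    [a + h - 1], which by strict concavity on (-1, 0) exceeds the one from [c - h] to [c] by
    [eta * h]. *)
Lemma kernel_exchange (d : R) : 0 < d -> exists2 eta, 0 < eta & forall a c h,
  d <= a -> 0 <= h -> a + h <= 1 - d -> c <= - d -> - 1 + d <= c - h ->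
  d <= c - (a + h - 1) ->
  branch K a * branch (K \o -%R) (- c) <= expR (- (eta * h)) *
    (branch K (a + h) * branch (K \o -%R) (- (c - h))).
Proof.
move=> d0; have [_ cl cr _ _] := kK.
have [eta eta0 gain] := strict_concave_gain cK.1 d0.
exists eta => // a c h da h0 ah cd ch dt.
have br u : 0 < u < 1 -> branch K u = expR (fine (K u)).
  by move=> uI; apply: branch_in => //; apply: kernel_fin; right.
have bl u : - 1 < u < 0 -> branch (K \o -%R) (- u) = expR (fine (K u)).
  move=> uI; rewrite branch_in /= ?opprK//; first by apply/andP; lra.
  by apply: kernel_fin; left.
rewrite !br ?bl; [|apply/andP; lra..].
rewrite -!expRD ler_expR.
have := @PM_increment_le _ _ cl cr pK a (a + h).
have := gain (a - 1) (a + h - 1) (c - (a + h - 1)).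
have -> : a + h - 1 + (c - (a + h - 1)) = c by ring.
have -> : a - 1 + (c - (a + h - 1)) = c - h by ring.
have -> : a + h - 1 - (a - 1) = h by ring.
move=> g p.
have {}g := g ltac:(lra) ltac:(lra) ltac:(lra) ltac:(lra).
have {}p := p ltac:(lra) ltac:(lra) ltac:(lra).
lra.
Qed.

End Kernel.

Lemma esum_single (A : set R) (x : R) (c : \bar R) : (0 <= c)%E ->
  (\esum_(t in A) (if t == x then c else 0) <= c)%E.
Proof.
move=> c0.
rewrite (eq_esum (b := fun t => if t \in [set x] then c else 0%E)); last first.
  by move=> t _; rewrite (_ : (t \in [set x]) = (t == x)) //;
    apply/idP/eqP; rewrite inE.
rewrite -esum_mkcondr.
have [Ax|Ax] := pselect (A x).
  rewrite (_ : A `&` [set x] = [set x]); first by rewrite esum_set1.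
  by apply/seteqP; split=> t [] // ->.
rewrite (_ : A `&` [set x] = set0); first by rewrite esum_set0.
by apply/seteqP; split=> t // [At tx]; apply: Ax; rewrite -tx.
Qed.

Lemma weight_ge0 (t : R) : (0 <= weight t)%E.
Proof. by rewrite /weight; case: ifP => _; rewrite lee_fin. Qed.

(* A node in (0, 1) blocks one point of weight 1; a node at an end point blocks
   that point and the opposite end, whose weights add up to 1 as well. *)
Lemma n_field_support n J (y : 'rV[R]_n) : n_field_function n J ->
  (forall i, 0 <= y ord0 i <= 1) -> exists t, [/\ 0 <= t <= 1,
    J t \is a fin_num & forall i, t != y ord0 i /\ `|t - y ord0 i| < 1].
Proof.
move=> [_ wJ] y01; apply: contrapT => h; move: wJ; apply/negP; rewrite -leNgt.
set A := [set t | _].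
pose d (x : R) : \bar R := if (x == 0) || (x == 1) then (2^-1)%:E else 0%E.
(* The charge of node [i] at [t]: the weight of the node at its own position, and a further 1/2 at
   the opposite end if the node is an end point. *)
pose a (t : R) (i : 'I_n) : \bar R := ((if t == y ord0 i then weight (y ord0 i) else 0)
  + (if (t == 1 - y ord0 i)%R then d (y ord0 i) else 0))%E.
have d0 x : (0 <= d x)%E by rewrite /d; case: ifP => _; rewrite lee_fin.
have a01 t i : (0 <= if t == y ord0 i then weight (y ord0 i) else 0)%E.
  by case: ifP => // _; exact: weight_ge0.
have a02 t i : (0 <= if (t == 1 - y ord0 i)%R then d (y ord0 i) else 0)%E.
  by case: ifP.
have a0 t i : (0 <= a t i)%E by rewrite /a adde_ge0.
have step : (\esum_(t in A) weight t <= \esum_(t in A) \sum_i a t i)%E.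
  apply: le_esum => t [tI Jt]; rewrite in_itv/= in tI.
  have [i hi] : exists i, t = y ord0 i \/ 1 <= `|t - y ord0 i|.
    apply: contrapT => hn; apply: h; exists t; split=> // i; split.
      by apply/eqP => e; apply: hn; exists i; left.
    by rewrite ltNge; apply/negP => e; apply: hn; exists i; right.
  rewrite (bigD1 i)//=.
  have rest : (0 <= \sum_(k < n | k != i) a t k)%E by apply: sume_ge0.
  suff : (weight t <= a t i)%E by move=> /le_trans; apply; rewrite leeDl.
  case: hi => [->|ti]; first by rewrite /a eqxx leeDl.
  have y01i := y01 i.
  have [[t0 yi]|[t1 yi]] : (t = 0 /\ y ord0 i = 1) \/ (t = 1 /\ y ord0 i = 0).
    move: ti tI y01i; rewrite ler_normr => /orP[ti|ti] /andP[? ?] /andP[? ?].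
      by right; split; apply/eqP; rewrite eq_le; apply/andP; lra.
    by left; split; apply/eqP; rewrite eq_le; apply/andP; lra.
  - by rewrite /a /weight /d t0 yi subrr !eqxx orbT (eq_sym 0) oner_eq0 add0e.
  - by rewrite /a /weight /d t1 yi subr0 !eqxx orbT oner_eq0 add0e.
apply: (le_trans step); rewrite esum_sum//.
apply: (@le_trans _ _ (\sum_(i < n) 1)%E).
  apply: lee_sum => i _; rewrite esumD//.
  apply: (le_trans (leeD (esum_single _ _ (weight_ge0 _)) (esum_single _ _ (d0 _)))).
  rewrite /weight /d; case: ifP => _; last by rewrite adde0.
  by rewrite -EFinD lee_fin; lra.
by rewrite sumEFin sumr_const card_ord.
Qed.

End ExpOfExtended.

(** * Transfer to [Phi] and [Yset] *)

Section Link.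
Variables (R : realType) (n : nat) (K : 'I_n -> R -> \bar R) (J : R -> \bar R).
Hypotheses (kK : forall i, kernel_function (K i))
  (sK : forall i, singular_kernel (K i))
  (cK : forall i, strictly_concave_kernel (K i))
  (pK : forall i, PM 0 (K i)) (nJ : n_field_function n J)
  (J01 : (J 0 = -oo%E /\ J t @[t --> 0^'+] --> -oo%E) \/
         (J 1 = -oo%E /\ J t @[t --> 1^'-] --> -oo%E)).

Arguments ypt : simpl never.

Definition field_weight (t : R) : R :=
  if 0 <= t <= 1 then fine (expeR (J t)) else 0.

Lemma field_neqy t : 0 <= t <= 1 -> J t != +oo%E.
Proof.
move=> tI; have [[m hm] _] := nJ.
by have := hm t; rewrite in_itv => /(_ tI); case: (J t).
Qed.

Lemma field_weight_ge0 t : 0 <= field_weight t.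
Proof.
by rewrite /field_weight; case: ifP => // _; rewrite fine_ge0// expeR_ge0.
Qed.

Lemma field_weight_bound : exists2 W, 0 < W & forall t, field_weight t <= W.
Proof.
have [[m hm] _] := nJ; exists (expR m) => [|t]; first exact: expR_gt0.
rewrite /field_weight; case: ifP => [tI|_]; last exact: expR_ge0.
have := hm t; rewrite in_itv/= => /(_ tI).
by case: (J t) => [s|//|_] /=; rewrite ?expR_ge0// lee_fin ler_expR.
Qed.

Lemma field_weight_small e t : 0 < e -> (J t < (ln e)%:E)%E ->
  field_weight t < e.
Proof.
move=> e0; rewrite /field_weight; case: ifP => // _.
case: (J t) => [s|//|_] //=.
by rewrite lte_fin -{2}(lnK e0) ltr_expR.
Qed.

Lemma field_weight_end : (forall e, 0 < e -> exists2 d, 0 < d &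
    forall t, 0 <= t <= 1 -> e <= field_weight t -> d <= t) \/
  (forall e, 0 < e -> exists2 d, 0 < d &
    forall t, 0 <= t <= 1 -> e <= field_weight t -> t <= 1 - d).
Proof.
case: J01 => -[Jend Jlim]; [left|right] => e e0.
- have [d /= d0 hd] := cvgeNy_lt Jlim (ln e).
  exists d => // t /andP[t0 _] et; rewrite leNgt; apply/negP => td.
  have : field_weight t < e; last by rewrite ltNge et.
  apply: field_weight_small => //.
  move: t0; rewrite le_eqVlt => /predU1P[<-|t0]; first by rewrite Jend ltNyr.
  by apply: hd => //=; rewrite sub0r normrN gtr0_norm.
- have [d /= d0 hd] := cvgeNy_lt Jlim (ln e).
  exists d => // t /andP[_ t1] et; rewrite leNgt; apply/negP => td.
  have : field_weight t < e; last by rewrite ltNge et.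
  apply: field_weight_small => //.
  move: t1; rewrite le_eqVlt => /predU1P[->|t1]; first by rewrite Jend ltNyr.
  by apply: hd => //=; rewrite gtr0_norm; lra.
Qed.

Lemma field_weight_support (y : 'rV[R]_n) : (forall i, 0 <= y ord0 i <= 1) ->
  exists t, [/\ 0 <= t <= 1, 0 < field_weight t &
    forall i, t != y ord0 i /\ `|t - y ord0 i| < 1].
Proof.
move=> /(n_field_support nJ)[t [tI Jt ty]]; exists t; split=> //.
by rewrite /field_weight tI; case: (J t) Jt => //= s _; exact: expR_gt0.
Qed.

Definition kernel_translates : translates R n :=
  Translates field_weight_ge0 field_weight_bound
    (fun i => half_kernel_right (kK i) (sK i))
    (fun i => half_kernel_left (kK i) (sK i))
    (fun i => @kernel_exchange _ _ (kK i) (cK i) (pK i))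
    field_weight_end field_weight_support.

Local Notation T := kernel_translates.
Implicit Types (y : 'rV[R]_n) (i : 'I_n).

Lemma ypt_ord y i : ypt y i.+1 = y ord0 i.
Proof. by rewrite /ypt valK. Qed.

Lemma ypt_last y : ypt y n.+1 = 1.
Proof. by rewrite /ypt insubN// ltnn. Qed.

Lemma Sset_le y j k : Sset y -> (j <= k)%N -> (k <= n.+1)%N ->
  ypt y j <= ypt y k.
Proof.
move=> Sy; elim: k => [|k IH]; first by rewrite leqn0 => /eqP ->.
rewrite leq_eqVlt => /predU1P[->//|jk] kn.
by apply: (le_trans (IH jk (ltnW kn))); apply/ltW/Sy.
Qed.

Lemma Sset_range y i : Sset y -> 0 < y ord0 i < 1.
Proof.
move=> Sy; rewrite -ypt_ord -(ypt_last y).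
have i1 := ltn_ord i.
apply/andP; split.
  apply: (@le_lt_trans _ _ (ypt y i)); last by apply: Sy; exact: ltnW.
  by apply: (@Sset_le y 0) => //; exact: leqW (ltnW i1).
by apply: (@lt_le_trans _ _ (ypt y i.+2)); [exact: Sy|exact: Sset_le].
Qed.

Lemma Sset_interval y j t : Sset y -> (j <= n)%N ->
  t \in `[ypt y j, ypt y j.+1] -> 0 <= t <= 1.
Proof.
move=> Sy jn; rewrite in_itv/= => /andP[jt tj]; apply/andP; split.
  by apply: le_trans jt; apply: (@Sset_le y 0) => //; exact: leqW.
by apply: (le_trans tj); rewrite -(ypt_last y); exact: Sset_le.
Qed.

(** On interval [j] the sign of [t - y ord0 i] agrees with the branch chosen by [fac]; at the node
    itself singularity makes both sides 0. *)
Lemma expeR_kernel y j t i : Sset y -> (j <= n)%N ->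
  t \in `[ypt y j, ypt y j.+1] ->
  expeR (K i (t - y ord0 i)) = (fac T j i (t - y ord0 i))%:E.
Proof.
move=> Sy jn tj; have /andP[t0 t1] := Sset_interval Sy jn tj.
have /andP[y0 y1] := Sset_range i Sy.
move: tj; rewrite in_itv/= => /andP[jt tj].
have in_branch (k : R -> \bar R) s : k 0 = -oo%E ->
    (0 < s < 1 -> k s \is a fin_num) -> 0 <= s < 1 ->
    expeR (k s) = (branch k s)%:E.
  move=> k0 ks /andP[s0 s1]; move: s0; rewrite le_eqVlt => /predU1P[<-|s0].
    by rewrite k0 /branch lexx.
  have sI : 0 < s < 1 by rewrite s0.
  by rewrite branch_in ?ks// -{1}(fineK (ks sI)).
rewrite /fac /=; case: ltnP => ij.
  have yit : y ord0 i <= t.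
    apply: le_trans jt; rewrite -ypt_ord; apply: Sset_le => //.
    exact: leqW.
  apply: in_branch; first exact: sK.
    by move=> sI; apply: (kernel_fin (kK i)); right.
  by apply/andP; lra.
have tyi : t <= y ord0 i.
  apply: (le_trans tj); rewrite -ypt_ord; apply: Sset_le => //.
  exact: leqW.
rewrite -[X in expeR (K i X)]opprK.
apply: (in_branch (K i \o -%R)) => /=; first by rewrite oppr0; exact: sK.
  by move=> sI; apply: (kernel_fin (kK i)); left; apply/andP; lra.
by apply/andP; lra.
Qed.

Lemma expeR_Ffun y j t : Sset y -> (j <= n)%N ->
  t \in `[ypt y j, ypt y j.+1] ->
  expeR (Ffun J K y t) = (Hval T j y t)%:E.
Proof.
move=> Sy jn tj; have tI := Sset_interval Sy jn tj.
rewrite /Ffun expeRD /Hval EFinM /= /field_weight tI -expeR_fin ?field_neqy//.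
congr (_ * _)%E; rewrite (big_morph expeR (@expeRD R) (@expeR0 R)) -prodEFin.
by apply: eq_bigr => i _; exact: expeR_kernel.
Qed.

Lemma Hval_out y j t : (j <= n)%N -> 0 <= t <= 1 ->
  t \notin `[ypt y j, ypt y j.+1] -> Hval T j y t = 0.
Proof.
move=> jn /andP[t0 t1] tj; apply/eqP; rewrite eq_le Hval_ge0 andbT leNgt.
apply/negP => Ht; have [_ f0] := Hval_gt0_fac Ht.
move: tj; rewrite in_itv/= => /negP; apply; apply/andP; split.
  case: j jn Ht f0 => [//|j] jn Ht f0.
  have := fac_gt0_side (f0 (Ordinal jn)).
  by rewrite /= ltnSn -(ypt_ord _ (Ordinal jn)) subr_gt0 => /ltW.
move: jn; rewrite leq_eqVlt => /predU1P[jn|jn]; first by rewrite jn ypt_last.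
have := fac_gt0_side (f0 (Ordinal jn)).
by rewrite /= ltnn -(ypt_ord _ (Ordinal jn)) subr_lt0 => /ltW.
Qed.

(** Off the interval the product is 0 and adds nothing to the supremum. As [lne] sends 0 to -oo,
    degenerate intervals are covered too. *)
Lemma msupE y j : Sset y -> (j <= n)%N ->
  msup J K y j = lne (Mval T j y)%:E.
Proof.
move=> Sy jn; apply/eqP; rewrite eq_le; apply/andP; split.
  apply: ge_ereal_sup => _ [t tj <-]; rewrite -lee_expeR (expeR_Ffun Sy jn tj).
  rewrite lneK ?in_itv/= ?lee_fin ?Mval_ge0 ?leey// .
  by apply: Hval_le_Mval; exact: Sset_interval tj.
rewrite -lee_expeR lneK ?in_itv/= ?lee_fin ?Mval_ge0 ?leey//.
have := expeR_ge0 (msup J K y j).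
have bound t : t \in `[ypt y j, ypt y j.+1] ->
    ((Hval T j y t)%:E <= expeR (msup J K y j))%E.
  move=> tj; rewrite -(expeR_Ffun Sy jn tj) lee_expeR.
  by apply: ereal_sup_ubound; exists t.
move: bound; case: (expeR _) => [r| |] bound //= r0; last by rewrite leey.
rewrite lee_fin; apply: Mval_le => t tI.
have [tj|tj] := boolP (t \in `[ypt y j, ypt y j.+1]).
  by rewrite -lee_fin bound.
by rewrite Hval_out// -lee_fin.
Qed.

Lemma YsetP y : Yset J K y <-> Mpos T y.
Proof.
split=> [[Sy mY] j jn|My].
  have := mY j jn; rewrite msupE//; apply: contraR; rewrite -leNgt => M0.
  by apply/eqP/le0_lneNy; rewrite lee_fin.
have Sy : Sset y.
  move=> j jn; have [t /andP[t0 t1] Ht] := Mval_gt0_ex (My j jn).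
  have [_ f0] := Hval_gt0_fac Ht.
  (* The point [t] lies strictly on the correct side of each neighbouring node; an outer interval
     has only one such node, and for [n = 0] the claim is [0 < 1]. *)
  have up : (j < n)%N -> t < ypt y j.+1.
    move=> lt_jn; have := fac_gt0_side (f0 (Ordinal lt_jn)).
    by rewrite /= ltnn -(ypt_ord _ (Ordinal lt_jn)) subr_lt0.
  have up1 : t <= ypt y j.+1.
    move: jn; rewrite leq_eqVlt => /predU1P[->|/up/ltW//].
    by rewrite ypt_last.
  case: j jn Ht f0 up up1 => [|j] jn Ht f0 up up1.
    have [n0|n0] := posnP n; last exact: le_lt_trans (up n0).
    by rewrite -[1%N in X in _ < X]/(0.+1) -{2}n0 ypt_last.
  apply: lt_le_trans up1.
  have := fac_gt0_side (f0 (Ordinal jn)).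
  by rewrite /= ltnSn -(ypt_ord _ (Ordinal jn)) subr_gt0.
split=> // j jn; rewrite msupE// lne_EFin//.
exact: My.
Qed.

Lemma Phi_Psi y : Mpos T y -> Phi J K y = Psi T y.
Proof.
move=> My; have [Sy _] := (YsetP y).2 My.
apply/rowP => i; rewrite !mxE.
have i1 := ltn_ord i; have i0 := ltnW i1.
by rewrite !msupE// !lne_EFin ?My.
Qed.

Lemma homeomorphism_Phi : homeomorphism_onto (Yset J K) (Phi J K).
Proof.
have /choice[g gP] c : exists y, Mpos T y /\ Psi T y = c.
  by have [y My Pc] := Psi_surj T c; exists y.
exists g; split=> [c|c|y /YsetP My||c].
- by apply/YsetP; exact: (gP c).1.
- by rewrite Phi_Psi ?(gP c).2//; exact: (gP c).1.
- rewrite Phi_Psi//; apply: (Psi_inj (gP _).1 My); exact: (gP _).2.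
- apply/subspace_continuousP => y /[dup] Yy /YsetP My.
  have [e e0 [L L0 h]] := Psi_bilip My.
  apply/cvgrPdist_lt => r r0.
  have d0 : 0 < Num.min e (r / L) by rewrite lt_min e0 divr_gt0.
  have := nbhsx_ballx y _ d0; apply: filterS => z yz Yz.
  have Mz := (YsetP z).1 Yz.
  suff : `|Phi J K y - Phi J K z| < r by [].
  rewrite (Phi_Psi My) (Phi_Psi Mz).
  have ye : ball y e z by apply: le_ball yz; rewrite ge_min lexx.
  have [_ /le_lt_trans ->//] := h y z My Mz (ballxx y e0) ye.
  rewrite mulrC -ltr_pdivlMr//.
  have : ball y (r / L) z by apply: le_ball yz; rewrite ge_min lexx orbT.
  by rewrite -ball_normE.
- apply/(@cvgrPdist_lt _ _ _ _ (nbhs_filter c)) => e e0.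
  have [d d0 h] := Psi_inv_continuous (gP c).1 e0.
  have := nbhsx_ballx c d d0; apply: filterS => c' cc'.
  by apply: h; [exact: (gP c').1|rewrite !(gP _).2; rewrite -ball_normE in cc'].
Qed.

Lemma bilipschitz_Phi : locally_bilipschitz_on (Yset J K) (Phi J K).
Proof.
move=> y /YsetP My; have [e e0 [L L0 h]] := Psi_bilip My.
exists e => //; exists L => // a b /YsetP Ma /YsetP Mb ya yb.
by rewrite !Phi_Psi//; exact: h.
Qed.

End Link.

Unset Implicit Arguments.

Theorem theorem7p1 (R : realType) (n : nat) (K : 'I_n -> R -> \bar R)
  (J : R -> \bar R) :
  (forall i, kernel_function (K i)) ->
  (forall i, singular_kernel (K i)) ->
  (forall i, strictly_concave_kernel (K i)) ->
  (forall i, PM 0 (K i)) ->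
  n_field_function n J ->
  ((J 0 = -oo%E /\ J t @[t --> 0^'+] --> -oo%E) \/
   (J 1 = -oo%E /\ J t @[t --> 1^'-] --> -oo%E)) ->
  homeomorphism_onto (Yset J K) (Phi J K) /\
  locally_bilipschitz_on (Yset J K) (Phi J K).
Proof.
move=> kK sK cK pK nJ J01; split.
  exact: (homeomorphism_Phi kK sK cK pK nJ J01).
exact: (bilipschitz_Phi kK sK cK pK nJ J01).
Qed.
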